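(* Let $M\in\mathbb{N}_0$ and let $(Y_k(n))_{k\in\mathbb{N}_0}$, $n\ge M$, $n\in\mathbb{N}$, be nonincreasing Markov chains with $Y_0(n)=n$ and common transition probabilities $(s_{i,j})$ absorbed at $M$, with $s_{i,i-1}>0$ for every $i\ge M+1$. Let $Z_n$ be the number of zero decrements of $(Y_k(n))_{k\in\mathbb{N}_0}$ before absorption. If $Z_n$ converges in distribution, as $n\to\infty$, to a random variable $Z$ with a proper and nondegenerate probability law, then this law is mixed Poisson.
   Context: $\mathbb{N}_0=\{0,1,2,\ldots\}$. The transition probabilities, which do not depend on $n$ or on $k$, are as follows: for $i\ge M+1$ and $M\le j\le i$, $\mathbb{P}\{Y_k(n)=j\mid Y_{k-1}(n)=i\}=s_{i,j}$; $\mathbb{P}\{Y_k(n)=j\mid Y_{k-1}(n)=i\}=0$ for $i<j$; and $\mathbb{P}\{Y_k(n)=M\mid Y_{k-1}(n)=M\}=1$. The states are the integers $\ge M$. The assumption $s_{i,i-1}>0$ for all $i\ge M+1$ ensures that absorption at $M$ is certain. The number of zero decrements before absorption is $$Z_n:=\#\{k\in\mathbb{N}_0:\ Y_k(n)-Y_{k+1}(n)=0,\ Y_k(n)>M\},$$ which is a.s. finite. A law on $\mathbb{N}_0$ is mixed Poisson if it is the law of $\pi(\Lambda)$, where $(\pi(t))_{t\ge0}$ is a unit rate Poisson process and $\Lambda$ is an a.s. finite nonnegative random variable independent of $\pi$. A law is proper if it is a probability law of an a.s. finite random variable. *)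

(* Defs.v *)
From HB Require Import structures.
From mathcomp Require Import all_boot all_order all_algebra.
From mathcomp Require Import all_classical all_reals all_analysis measurable_realfun.

Set Implicit Arguments.
Unset Strict Implicit.
Unset Printing Implicit Defensive.

Import Order.TTheory GRing.Theory Num.Theory.
Import numFieldNormedType.Exports.

Local Open Scope classical_set_scope.
Local Open Scope ring_scope.

(* P(A | B), meaningful when P B != 0 *)
Definition cond_prob d (T : measurableType d) (R : realType)
    (P : probability T R) (A B : set T) : R :=
  fine (P (A `&` B)) / fine (P B).

(* The Markov property and the one-step transition probabilities at once: the
   law of Y_(k+1) given the whole past depends on the present state only. *)
Definition markov_chain d (T : measurableType d) (R : realType)
    (P : probability T R) (s : nat -> nat -> R)
    (Y : nat -> {RV P >-> nat}) : Prop :=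
  forall (k : nat) (y : nat -> nat) (j : nat),
    let past := [set w | forall i, (i <= k)%N -> Y i w = y i] in
    P past != 0%E ->
    cond_prob P [set w | Y k.+1 w = j] past = s (y k) j.

(* [s] is a transition matrix on the states >= M that never moves upwards and
   for which M is absorbing; its values at i < M are irrelevant. *)
Definition nonincreasing_transition (R : realType) (M : nat)
    (s : nat -> nat -> R) : Prop :=
  [/\ forall i j, (M <= i)%N -> 0 <= s i j,
      forall i j, (M <= i)%N -> (i < j)%N || (j < M)%N -> s i j = 0,
      forall i, (M <= i)%N -> \sum_(M <= j < i.+1) s i j = 1
    & s M M = 1].

(* The integer difference Y_k - Y_(k+1) vanishes iff Y_k = Y_(k+1); subtraction
   on nat is truncated and would also count increments. *)
Definition zero_decrements (R : realType) (T : Type) (M : nat)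
    (Y : nat -> T -> nat) (w : T) : \bar R :=
  counting [set k | Y k w = Y k.+1 w /\ (M < Y k w)%N].

Definition ecdf d (T : measurableType d) (R : realType)
    (P : probability T R) (X : T -> \bar R) (x : R) : \bar R :=
  P [set w | (X w <= x%:E)%E].

(* The variables may live on different probability spaces. *)
Definition cvg_in_distribution (R : realType)
    (d : nat -> measure_display) (T : forall n, measurableType (d n))
    (P : forall n, probability (T n) R) (X : forall n, T n -> \bar R)
    d' (T' : measurableType d') (Q : probability T' R) (Z : T' -> \bar R) :
    Prop :=
  forall x : R, {for x, continuous (ecdf Q Z)} ->
    ecdf (P n) (X n) x @[n --> \oo] --> ecdf Q Z x.

Definition proper_law (R : realType) (mu : probability (\bar R) R) : Prop :=
  mu [set x | x \is a fin_num] = 1%E.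

Definition nondegenerate_law (R : realType) (mu : probability (\bar R) R) :
    Prop :=
  ~ exists c : \bar R, mu [set c] = 1%E.

(* Only the variables N t with t >= 0 matter. The second argument of
   [poisson_prob] is a dummy, and [poisson_prob 0 _] is the Dirac mass at 0. *)
Definition unit_poisson_process d (T : measurableType d) (R : realType)
    (P : probability T R) (N : R -> {RV P >-> nat}) : Prop :=
  [/\ forall w, N 0 w = 0%N,
      forall w (s t : R), 0 <= s -> s <= t -> (N s w <= N t w)%N,
      forall w (t : R), 0 <= t -> N u w @[u --> t^'+] --> N t w,
      forall (s t : R) (k : nat), 0 <= s -> s <= t ->
        P [set w | N t w = (N s w + k)%N] = poisson_prob (t - s) 0 [set k]
    & forall (m : nat) (t : nat -> R) (k : nat -> nat),
        0 <= t 0%N -> {homo t : i j / (i <= j)%N >-> i <= j} ->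
        P [set w | forall i, (i < m)%N -> N (t i.+1) w = (N (t i) w + k i)%N] =
        (\prod_(i < m) P [set w | N (t i.+1) w = (N (t i) w + k i)%N])%E].

Definition process_sigma_algebra d (T : measurableType d) (R : realType)
    (P : probability T R) (N : R -> {RV P >-> nat}) : set (set T) :=
  <<s [set A | exists (t : R) (B : set nat), 0 <= t /\ A = N t @^-1` B] >>.

Definition independent_of_process d (T : measurableType d) (R : realType)
    (P : probability T R) (N : R -> {RV P >-> nat}) (L : {RV P >-> R}) : Prop :=
  forall (A : set T) (B : set R),
    process_sigma_algebra N A -> measurable B ->
    P (A `&` L @^-1` B) = (P A * P (L @^-1` B))%E.

(* Laws on the nonnegative integers are seen as laws on \bar R. *)
Definition mixed_poisson (R : realType) (mu : probability (\bar R) R) : Prop :=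
  exists (d : measure_display) (T : measurableType d) (P : probability T R)
         (N : R -> {RV P >-> nat}) (L : {RV P >-> R}),
    [/\ unit_poisson_process N,
        forall w, 0 <= L w,
        independent_of_process N L
      & forall A : set (\bar R), measurable A ->
          mu A = P [set w | A (N (L w) w)%:R%:E]].

(* Main.v *)
Require Import Defs.
From HB Require Import structures.
From mathcomp Require Import all_boot all_order all_algebra.
From mathcomp Require Import all_classical all_reals all_analysis measurable_realfun.
From mathcomp Require Import ring lra.

Set Implicit Arguments.
Unset Strict Implicit.
Unset Printing Implicit Defensive.

Import Order.TTheory GRing.Theory Num.Theory.
Import numFieldNormedType.Exports.

Local Open Scope classical_set_scope.
Local Open Scope ring_scope.

(** Along its path the chain waits in each visited state [i] for a geometric
    number of steps with parameter [s i i], and given the visited states these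
    waits are independent. A geometric law is a Poisson law mixed by an
    exponential one, and Poisson laws add up; hence [Z_n] has the law of
    [pi(Lambda_n)], where [Lambda_n] is a random sum of exponential variables,
    and its generating function is [E z^Z_n = E exp(- (1 - z) Lambda_n)]. If
    [Z_n] converges to a proper law, these Laplace transforms converge to a
    function that tends to 1 at 0, so some subsequence of the laws of
    [Lambda_n] converges, and its limit mixes the law of [Z].

    The variable [Lambda_n] itself is replaced by discrete approximations.
    Multiplying by [c >= 1] the mean wait in every state gives another
    transition matrix [inv_thin s c], and [Z_n] is obtained from its number of
    zero decrements by keeping each of them with probability [1 / c]; in terms
    of generating functions this is [zpgf_inv_thin]. So the number of zero
    decrements for [inv_thin s c], divided by [c], approximates [Lambda_n], and
    [c = n + 1] makes the error vanish in the limit. The selection theorem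
    [laplace_limit] then yields a function [q >= 0] of a uniform variable with
    [E exp(- t q) = E (1 - t)^Z] for [0 < t < 1], and comparing coefficients of
    power series turns this into [P(Z = k) = E (q^k exp(- q) / k!)]: this is
    [mixture_of_limit].

    Two concrete tasks surround this argument. First, a Poisson process
    independent of [q] has to live on a probability space. The binary digits
    of even rank and those of odd rank of a uniform variable are two
    independent uniform variables ([unif_split]); iterating the splitting
    produces independent exponential gaps, and conditioning on the first gap
    gives the joint law of the increments ([unif_count_path]). Second, the law
    of [Z_n] has to be read off the Markov property: [zero_steps_law] does it
    by conditioning on the next state, up to a finite horizon, and this
    suffices because the [k]-th mass is settled after [n + k] steps
    ([zlaw_stable]). Since [Z_n] is integer valued, convergence of the
    distribution functions at continuity points puts the limit on the
    integers and gives convergence of every mass ([nat_valued_limit]). *)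

(** * Splitting a uniform variable into two independent uniform variables *)

(** The open rays are stable under intersection and generate the Borel
    sets. *)
Lemma measure_ray_unique (R : realType)
    (m1 m2 : {measure set (measurableTypeR R) -> \bar R}) :
  (m1 setT < +oo)%E ->
  (forall x : R, m1 `]x, +oo[%classic = m2 `]x, +oo[%classic) ->
  forall A, measurable A -> m1 A = m2 A.
Proof.
move=> m1oo m12 A mA.
apply: (@measure_unique _ R (measurableTypeR R) (@RGenOInfty.G R)
  (fun n : nat => `](- n%:R), +oo[%classic) _ _ _ _ m1 m2) => //.
- exact: RGenOInfty.measurableE.
- move=> _ _ [x ->] [y ->]; exists (Num.max x y).
  by apply/seteqP; split=> z /=; rewrite !in_itv/= !andbT gt_max => /andP.
- by move=> i; exists (- i%:R).
- rewrite -subTset => x _; exists (Num.truncn `|x|).+1 => //=.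
  rewrite in_itv/= andbT ltrNl (le_lt_trans (ler_norm _))// normrN.
  exact: truncnS_gt.
- by move=> _ [x ->].
- move=> k; rewrite (le_lt_trans _ m1oo)// le_measure ?inE//=.
Qed.

Section uniform_splitting.
Variable R : realType.

Definition unif : probability (measurableTypeR R) R := uniform_prob (@ltr01 R).

Lemma unifE (A : set R) : measurable A ->
  unif A = lebesgue_measure (A `&` `[0, 1]%classic).
Proof.
move=> mA; rewrite /unif/= /uniform_prob integral_uniform_pdf.
rewrite (eq_integral (fun=> 1%:E)) ?integral_cst ?mul1e//.
  exact: measurableI.
by move=> x; rewrite inE/= in_itv/= /uniform_pdf => -[_ ->]; rewrite subr0 invr1.
Qed.

(** On [[0, 1]], [bit x] is the first binary digit of [x] and [dbl] shifts the
    expansion by one digit. *)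
Definition bit (x : R) : R := if 1 / 2 <= x then 1 else 0.

Definition dbl (x : R) : R := 2 * x - bit x.

(** The number in [[0, 1]] whose first [n] binary digits are the digits of [x]
    of rank 0, 2, 4, and so on; [odds] collects the other ranks. *)
Fixpoint evens_trunc n (x : R) : R :=
  if n is n'.+1 then (bit x + evens_trunc n' (dbl (dbl x))) / 2 else 0.

Definition evens (x : R) : R := limn (evens_trunc ^~ x).

Definition odds (x : R) : R := evens (dbl x).

Lemma evens_trunc01 n x : 0 <= evens_trunc n x <= 1.
Proof.
elim: n x => [|n IH] x /=; first by rewrite lexx ler01.
by have := IH (dbl (dbl x)); rewrite /bit; case: ifP => _; lra.
Qed.

Lemma evens_trunc_nd x : nondecreasing_seq (evens_trunc ^~ x).
Proof.
apply/nondecreasing_seqP => n; elim: n x => [|n IH] x.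
  by have /andP[] := evens_trunc01 1 x.
by rewrite /= ler_pM2r ?invr_gt0// lerD2l IH.
Qed.

Lemma evens_trunc_cvg x : evens_trunc n x @[n --> \oo] --> evens x.
Proof.
apply: nondecreasing_is_cvgn (evens_trunc_nd x) _; exists 1 => _ [n _ <-].
by have /andP[] := evens_trunc01 n x.
Qed.

Lemma evens_rec x : evens x = (bit x + odds (dbl x)) / 2.
Proof.
have h1 : evens_trunc n.+1 x @[n --> \oo] --> evens x.
  by rewrite (cvg_shiftS (evens_trunc ^~ x)); exact: evens_trunc_cvg.
apply: (cvg_unique _ h1) => //=.
by apply: cvgMl; apply: cvgD; [exact: cvg_cst|exact: evens_trunc_cvg].
Qed.

Lemma measurable_bit : measurable_fun setT bit.
Proof. by apply: measurable_fun_if => //; exact: measurable_fun_ler. Qed.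

Lemma measurable_dbl : measurable_fun setT dbl.
Proof.
apply: measurable_funB; first exact: measurable_funM.
exact: measurable_bit.
Qed.

Lemma measurable_evens_trunc n : measurable_fun setT (evens_trunc n).
Proof.
elim: n => [|n IH] /=; first exact: measurable_cst.
apply: measurable_funM => //; apply: measurable_funD.
  exact: measurable_bit.
by apply: (measurableT_comp IH); apply: measurableT_comp; exact: measurable_dbl.
Qed.

Lemma measurable_evens : measurable_fun setT evens.
Proof.
by apply: measurable_fun_cvg => [n|x _]; [exact: measurable_evens_trunc|exact: evens_trunc_cvg].
Qed.

Lemma measurable_odds : measurable_fun setT odds.
Proof. exact: measurableT_comp measurable_evens measurable_dbl. Qed.

Lemma unif_setT : unif setT = 1%E.
Proof. exact: probability_setT. Qed.

Definition unif_tail (x : R) : R := if x < 0 then 1 else if x < 1 then 1 - x else 0.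

Lemma unif_ray x : unif `]x, +oo[%classic = (unif_tail x)%:E.
Proof.
rewrite unifE//; rewrite /unif_tail; case: ltP => x0; [|case: ltP => x1].
- rewrite (_ : _ `&` _ = `[0, 1]%classic).
    by rewrite lebesgue_measure_itv/= lte_fin ltr01 -EFinB subr0.
  apply/seteqP; split => y /=; rewrite !in_itv/=; first by case.
  by move=> /andP[y0 y1]; rewrite y0 y1 (lt_le_trans x0 y0).
- rewrite (_ : _ `&` _ = `]x, 1]%classic).
    by rewrite lebesgue_measure_itv/= lte_fin x1 -EFinB.
  apply/seteqP; split => y /=; rewrite !in_itv/= andbT.
    by move=> [-> /andP[_ ->]].
  by move=> /andP[xy ->]; rewrite xy (ltW (le_lt_trans x0 xy)).
- rewrite (_ : _ `&` _ = set0) ?measure0//.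
  apply/seteqP; split => y //=; rewrite !in_itv/= andbT => -[xy /andP[_ y1]].
  by move: (lt_le_trans xy y1); rewrite ltNge x1.
Qed.

(** With [c] the mass of [B], this says that [f] is uniform and independent of
    [B] as soon as this holds on rays. *)
Lemma unif_factor d (T : measurableType d) (m : probability T R)
    (B : set T) (f : T -> R) (c : R) :
  measurable B -> measurable_fun setT f -> 0 <= c ->
  (forall x, m (B `&` f @^-1` `]x, +oo[%classic) = c%:E * (unif_tail x)%:E)%E ->
  forall A, measurable A -> m (B `&` f @^-1` A) = (c%:E * unif A)%E.
Proof.
move=> mB mf c0 H A mA.
pose f' : T -> measurableTypeR R := f.
have mf' : measurable_fun setT f' by [].
pose nu : {measure set (measurableTypeR R) -> \bar R} := pushforward (mrestr m mB) f'.
have nuE C : nu mf' C = m (B `&` f @^-1` C) by rewrite /nu/= /pushforward/mrestr setIC.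
pose nu' : {measure set (measurableTypeR R) -> \bar R} := mscale (NngNum c0) unif.
have nu'E C : nu' C = (c%:E * unif C)%E by [].
rewrite -nu'E -nuE; apply: (@measure_ray_unique R (nu mf') nu') => // [|x].
  by rewrite nuE preimage_setT setIT (le_lt_trans (probability_le1 _ _))// ltry.
by rewrite nuE nu'E H unif_ray.
Qed.

(** On each half of [[0, 1]], [dbl] is affine with slope 2. *)
Lemma unif_dbl_half (c : bool) A : measurable A ->
  unif ([set x | bit x = c%:R] `&` dbl @^-1` A) = (2^-1%:E * unif A)%E.
Proof.
move=> mA.
have mc : measurable [set x | bit x = c%:R].
  by have := measurable_bit measurableT (measurable_set1 c%:R); rewrite setTI.
apply: unif_factor => //.
  exact: measurable_dbl.
move=> x; rewrite unifE; last first.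
  apply: measurableI => //.
  have := measurable_dbl measurableT (measurable_itv `]x, +oo[%O).
  by rewrite setTI.
have bE y : (bit y = c%:R) <-> (c = (1 / 2 <= y)).
  rewrite /bit; case: c {mc} => /=; case: leP => //= _; split=> // /eqP.
    by rewrite eq_sym oner_eq0.
  by rewrite oner_eq0.
case: c mc bE => mc bE.
- rewrite (_ : _ `&` _ = `[1 / 2, 1] `&` `](x + 1) / 2, +oo[)%classic.
    rewrite /unif_tail; case: ltP => x0; [|case: ltP => x1].
    - rewrite (_ : _ `&` _ = `[1 / 2, 1]%classic).
        by rewrite lebesgue_measure_itv/= lte_fin ifT -?EFinB ?mulr1; [congr EFin|]; lra.
      apply/seteqP; split => y /=; rewrite !in_itv/= andbT; first by case.
      by move=> /andP[y1 y2]; rewrite y1 y2; split => //; lra.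
    - rewrite (_ : _ `&` _ = `](x + 1) / 2, 1]%classic).
        rewrite lebesgue_measure_itv/= lte_fin ifT -?EFinB -?EFinM; last lra.
        by congr EFin; lra.
      apply/seteqP; split => y /=; rewrite !in_itv/= andbT.
        by move=> [/andP[y1 y2] y3]; rewrite y3 y2.
      by move=> /andP[y1 y2]; rewrite y1 y2; split => //; rewrite andbT; lra.
    - rewrite (_ : _ `&` _ = set0) ?measure0 ?mule0//.
      by apply/seteqP; split => y //=; rewrite !in_itv/= andbT => -[/andP[y1 y2] y3]; lra.
  apply/seteqP; split => y/=; rewrite !in_itv/= !andbT.
    by move=> [[/bE by_]]; rewrite /dbl /bit -by_; split; lra.
  move=> [/andP[y1 y2] y3]; split; last lra.
    split; first by apply/bE; rewrite y1.
  rewrite /dbl /bit y1; lra.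
- rewrite (_ : _ `&` _ = `[0, 1 / 2[ `&` `]x / 2, +oo[)%classic.
    rewrite /unif_tail; case: ltP => x0; [|case: ltP => x1].
    - rewrite (_ : _ `&` _ = `[0, 1 / 2[%classic).
        by rewrite lebesgue_measure_itv/= lte_fin ifT -?EFinB ?mulr1; [congr EFin|]; lra.
      apply/seteqP; split => y /=; rewrite !in_itv/= andbT; first by case.
      by move=> /andP[y1 y2]; rewrite y1 y2; split => //; lra.
    - rewrite (_ : _ `&` _ = `]x / 2, 1 / 2[%classic).
        rewrite lebesgue_measure_itv/= lte_fin ifT -?EFinB -?EFinM; last lra.
        by congr EFin; lra.
      apply/seteqP; split => y /=; rewrite !in_itv/= andbT.
        by move=> [/andP[y1 y2] y3]; rewrite y3 y2.
      by move=> /andP[y1 y2]; rewrite y1 y2; split => //; rewrite andbT; lra.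
    - rewrite (_ : _ `&` _ = set0) ?measure0 ?mule0//.
      by apply/seteqP; split => y //=; rewrite !in_itv/= andbT => -[/andP[y1 y2] y3]; lra.
  apply/seteqP; split => y/=; rewrite !in_itv/= !andbT.
    by move=> [[/bE by_]]; rewrite /dbl /bit -by_; split; lra.
  move=> [/andP[y1 y2] y3]; split; last lra.
    have nh : (1 / 2 <= y) = false by apply/negbTE; rewrite -ltNge.
    split; first by apply/bE; rewrite nh.
  rewrite /dbl /bit nh; lra.
Qed.

Lemma unif_tail_half x : unif_tail x = 2^-1 * (unif_tail (2 * x) + unif_tail (2 * x - 1)).
Proof.
rewrite /unif_tail; do ?case: ltP => ?; lra.
Qed.

(** The first digit is a fair coin independent of the following ones. *)
Lemma unif_bit_split (f : R -> R -> Prop) (A : set R) :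
  (forall c : bool, measurable [set y | f c%:R y]) ->
  (forall x, A x <-> f (bit x) (dbl x)) ->
  (unif A = 2^-1%:E * (unif [set y | f (0%R : R) y] + unif [set y | f (1%R : R) y]))%E.
Proof.
move=> mf Af.
have bitb x : exists c : bool, bit x = c%:R.
  by rewrite /bit; case: leP => _; [exists true|exists false].
have mc (c : bool) : measurable ([set x | bit x = c%:R] `&` dbl @^-1` [set y | f c%:R y]).
  apply: measurableI.
    by have := measurable_bit measurableT (measurable_set1 c%:R); rewrite setTI.
  by have := measurable_dbl measurableT (mf c); rewrite setTI.
rewrite muleDr ?ge0_adde_def ?inE ?measure_ge0//.
have h0 := unif_dbl_half false (mf false); have h1 := unif_dbl_half true (mf true).
rewrite -[X in (X + _)%E]h0 -[X in (_ + X)%E]h1 -measureU//; [|exact: mc false|exact: mc true|].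
  congr (unif _); apply/seteqP; split => x /=.
    move=> /Af; have [[] ->] := bitb x; tauto.
  by case=> -[e h]; apply/Af; rewrite e.
apply/seteqP; split => x //= [[-> _] [/eqP]].
by rewrite eq_sym oner_eq0.
Qed.

(** Iterating the inequality bounds every value of [e] by all powers of 1/2. *)
Lemma halving_zero (T : Type) (e : T -> R) (nx : T -> T) :
  (forall t, 0 <= e t <= 1) -> (forall t, e t <= 2^-1 * e (nx t)) ->
  forall t, e t = 0.
Proof.
move=> e01 enx t.
have H n : forall t, e t <= 2^-1 ^+ n.
  elim: n => [t'|n IH t']; first by rewrite expr0; case/andP: (e01 t').
  by rewrite exprS (le_trans (enx t'))// ler_pM2l ?invr_gt0// IH.
apply/eqP; rewrite eq_le; have /andP[-> _] := e01 t; rewrite andbT.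
have h : (2^-1 : R) ^+ n @[n --> \oo] --> 0.
  by apply: cvg_expr; rewrite gtr0_norm// invf_lt1// ltr1n.
rewrite -(cvg_lim _ h)//; apply: limr_ge; first by apply/cvg_ex; exists 0.
by apply: nearW => n; exact: H.
Qed.

Lemma unif_dbl A : measurable A -> unif (dbl @^-1` A) = unif A.
Proof.
move=> mA; rewrite (unif_bit_split (f := fun _ y => A y))//.
rewrite -(@fineK _ (unif A)) ?fin_num_measure// -EFinD -EFinM; congr EFin; lra.
Qed.

Lemma evens01 x : 0 <= evens x <= 1.
Proof.
have h := @evens_trunc_cvg x.
apply/andP; split.
  apply: (limr_ge (cvgP _ h)); apply: nearW => n; by case/andP: (evens_trunc01 n x).
apply: (limr_le (cvgP _ h)); apply: nearW => n; by case/andP: (evens_trunc01 n x).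
Qed.

Lemma measurable_gt (f : R -> R) (c : R) : measurable_fun setT f ->
  measurable [set y | c < f y].
Proof.
move=> mf; have := mf measurableT _ (measurable_itv `]c, +oo[).
by rewrite setTI; congr measurable; apply/seteqP; split=> y /=; rewrite in_itv/= andbT.
Qed.

(** The first digit of [x] is also the first digit of [evens x]; once it is
    removed, the even and the odd ranks exchange their roles. The recursion
    characterizes the joint law, because [unif_tail] satisfies it as well and
    the error is halved at each step. *)
Lemma joint_rec a b : unif [set x | a < evens x /\ b < odds x] =
  (2^-1%:E * (unif [set x | b < evens x /\ 2 * a < odds x]%R +
             unif [set x | b < evens x /\ 2 * a - 1 < odds x]%R))%E.
Proof.
rewrite (unif_bit_split (f := fun c y => b < evens y /\ 2 * a - c < odds y)).
- by rewrite subr0.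
- move=> c; apply: (@measurableI _ _ [set y | b < evens y] [set y | 2 * a - c%:R < odds y]).
    exact: (measurable_gt _ measurable_evens).
  exact: (measurable_gt _ measurable_odds).
- move=> x /=; rewrite evens_rec -/(odds x). by split=> -[]; split=> //; lra.
Qed.

Let G a b := fine (unif [set x | a < evens x /\ b < odds x]).

Let mG a b : measurable [set x | a < evens x /\ b < odds x].
Proof.
apply: (@measurableI _ _ [set y | a < evens y] [set y | b < odds y]).
  exact: (measurable_gt _ measurable_evens).
exact: (measurable_gt _ measurable_odds).
Qed.

Let GE a b : unif [set x | a < evens x /\ b < odds x] = (G a b)%:E.
Proof. by rewrite /G fineK// fin_num_measure//; exact: mG. Qed.

Let G_rec a b : G a b = 2^-1 * (G b (2 * a) + G b (2 * a - 1)).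
Proof.
by apply/EFin_inj; rewrite -GE joint_rec !GE -EFinD -EFinM.
Qed.

Let odds01 x : 0 <= odds x <= 1. Proof. exact: evens01. Qed.

Let G01 a b : 0 <= G a b <= 1.
Proof.
by rewrite -!lee_fin -GE measure_ge0 probability_le1//; exact: mG.
Qed.

Let G_eq0 a b : 1 <= a \/ 1 <= b -> G a b = 0.
Proof.
move=> ab; rewrite /G (_ : [set x | _] = set0) ?measure0//.
apply/seteqP; split => x //= -[]; have := evens01 x; have := odds01 x.
by case: ab; lra.
Qed.

Let G_eq1 a b : a < 0 -> b < 0 -> G a b = 1.
Proof.
move=> a0 b0; rewrite /G (_ : [set x | _] = setT) ?probability_setT//.
apply/seteqP; split => x //= _; have := evens01 x; have := odds01 x; lra.
Qed.

Let G_odds a b : b < 0 -> G b a = G a b.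
Proof.
move=> b0; apply/EFin_inj; rewrite -!GE.
transitivity (unif (dbl @^-1` [set x | a < evens x])).
  congr (unif _); apply/seteqP; split => x /=; rewrite -/(odds x).
    by case.
  by move=> ->; split => //; have := evens01 x; lra.
rewrite unif_dbl; last exact: (measurable_gt _ measurable_evens).
congr (unif _); apply/seteqP; split => x /=; last by case.
by move=> ->; split => //; have := odds01 x; lra.
Qed.

Let unif_tail01 x : 0 <= unif_tail x <= 1.
Proof. by rewrite /unif_tail; do ?case: ltP => ?; lra. Qed.

Let unif_tail_ge1 x : 1 <= x -> unif_tail x = 0.
Proof. by rewrite /unif_tail; do ?case: ltP => ?; lra. Qed.

Let unif_tail_lt0 x : x < 0 -> unif_tail x = 1.
Proof. by rewrite /unif_tail; do ?case: ltP => ?; lra. Qed.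

Let G_marginal b a : b < 0 -> G a b = unif_tail a.
Proof.
move=> b0; apply/eqP; rewrite -subr_eq0 -normr_eq0; apply/eqP.
have out c : c < 0 \/ 1 <= c -> G c b - unif_tail c = 0.
  case=> c0; first by rewrite G_eq1// unif_tail_lt0// subrr.
  by rewrite G_eq0 ?unif_tail_ge1 ?subrr//; left.
(* Of [2 c] and [2 c - 1], one lies outside [0, 1[, where there is no error;
   [nx] selects the other one. *)
pose nx c : R := if c < 1 / 2 then 2 * c else 2 * c - 1.
apply: (@halving_zero R (fun c => `|G c b - unif_tail c|) nx) => c.
  by rewrite normr_ge0 ler_norml; have := G01 c b; have := unif_tail01 c; lra.
have -> : G c b - unif_tail c = 2^-1 * ((G (2 * c) b - unif_tail (2 * c)) + (G (2 * c - 1) b - unif_tail (2 * c - 1))).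
  by rewrite G_rec !(G_odds _ b0) [unif_tail c]unif_tail_half; lra.
rewrite normrM gtr0_norm ?invr_gt0//= ler_pM2l ?invr_gt0// /nx; case: ltP => hc.
  by rewrite [X in _ + X]out ?addr0//; left; lra.
by rewrite out ?add0r//; right; lra.
Qed.

Let G_joint a b : G a b = unif_tail a * unif_tail b.
Proof.
apply/eqP; rewrite -subr_eq0 -normr_eq0; apply/eqP.
have out c d : (c < 0 \/ 1 <= c) \/ (d < 0 \/ 1 <= d) -> G c d - unif_tail c * unif_tail d = 0.
  case=> -[h|h].
  - by rewrite unif_tail_lt0// mul1r G_odds// G_marginal// subrr.
  - by rewrite unif_tail_ge1// mul0r G_eq0 ?subrr//; left.
  - by rewrite (unif_tail_lt0 h) mulr1 G_marginal// subrr.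
  - by rewrite (unif_tail_ge1 h) mulr0 G_eq0 ?subrr//; right.
(* As above, for the second argument after the exchange of coordinates. *)
pose nx (t : R * R) : R * R := (t.2, if t.1 < 1 / 2 then 2 * t.1 else 2 * t.1 - 1).
apply: (@halving_zero _ (fun t => `|G t.1 t.2 - unif_tail t.1 * unif_tail t.2|) nx _ _ (a, b)) => -[c d] /=.
  rewrite normr_ge0 ler_norml; have := G01 c d; have := unif_tail01 c; have := unif_tail01 d => sd sc.
  have : 0 <= unif_tail c * unif_tail d <= 1 by rewrite mulr_ge0 ?mulr_ile1; lra.
  lra.
have -> : G c d - unif_tail c * unif_tail d = 2^-1 * ((G d (2 * c) - unif_tail d * unif_tail (2 * c)) + (G d (2 * c - 1) - unif_tail d * unif_tail (2 * c - 1))).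
  by rewrite G_rec [unif_tail c]unif_tail_half; lra.
rewrite normrM gtr0_norm ?invr_gt0//= ler_pM2l ?invr_gt0//; case: ltP => hc.
  by rewrite [X in _ + X]out ?addr0//; right; left; lra.
by rewrite [X in X + _]out ?add0r//; right; right; lra.
Qed.

Lemma unif_evens_odds A B : measurable A -> measurable B ->
  unif (evens @^-1` A `&` odds @^-1` B) = (unif A * unif B)%E.
Proof.
move=> mA mB.
have mE : measurable (evens @^-1` A).
  by have := measurable_evens measurableT mA; rewrite setTI.
rewrite -(@fineK _ (unif A)) ?fin_num_measure//.
apply: unif_factor => //; [exact: measurable_odds|exact: fine_ge0|].
move=> y; rewrite fineK ?fin_num_measure// muleC setIC.
have mO : measurable (odds @^-1` `]y, +oo[%classic).
  by have := measurable_odds measurableT (measurable_itv `]y, +oo[); rewrite setTI.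
apply: unif_factor => //; [exact: measurable_evens|by case/andP: (unif_tail01 y)|].
move=> x; rewrite -EFinM mulrC -G_joint -GE; congr (unif _).
by apply/seteqP; split => z /=; rewrite !in_itv/= !andbT => -[].
Qed.

(** Hence [odds w] can be split again, and so on: this replaces an infinite
    product of uniform laws. *)
Lemma unif_split (X : set (measurableTypeR R * measurableTypeR R)) : measurable X ->
  unif [set w | X (evens w, odds w)] = (unif \x unif)%E X.
Proof.
move=> mX.
pose f (w : measurableTypeR R) : measurableTypeR R * measurableTypeR R := (evens w, odds w).
have mf : measurable_fun setT f.
  by apply/measurable_fun_pairP; split; [exact: measurable_evens|exact: measurable_odds].
pose nu : {measure set (measurableTypeR R * measurableTypeR R) -> \bar R} := pushforward unif f.
rewrite (@product_measure_unique _ _ _ _ _ unif unif (nu mf))//.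
by move=> A B mA mB; rewrite -unif_evens_odds.
Qed.

End uniform_splitting.

(** * A unit rate Poisson process on the unit interval *)

Section renewal.
Variable R : realType.
Implicit Types (g : nat -> R) (t d : R).

(** At [t = 0] this is the Dirac mass at 0, since [0 ^+ 0 = 1]. *)
Definition pois t k : R := expR (- t) * (t ^+ k / k`!%:R).

Definition psum g n : R := \sum_(j < n) g j.

Definition count_at g t K : bool := psum g K <= t < psum g K.+1.

(** For a renewal process with gaps [g]: there are exactly [K] points up to
    time [t] and, for the entries [(d, k)] of [l] in turn, exactly [k] points
    during the next [d] units of time. *)
Fixpoint count_path g t K (l : seq (R * nat)) : bool :=
  count_at g t K &&
  (if l is dk :: l' then count_path g (t + dk.1) (K + dk.2)%N l' else true).

Lemma pois_ge0 t k : 0 <= t -> 0 <= pois t k.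
Proof. by move=> t0; rewrite /pois !mulr_ge0 ?expR_ge0 ?exprn_ge0. Qed.

Lemma psumS g n : psum g n.+1 = g 0%N + psum (fun j => g j.+1) n.
Proof. by rewrite /psum big_ord_recl. Qed.

Lemma psum_ge0 g n : (forall j, 0 <= g j) -> 0 <= psum g n.
Proof. by move=> g0; apply: sumr_ge0. Qed.

Lemma count_atS g t K : count_at g t K.+1 = count_at (fun j => g j.+1) (t - g 0%N) K.
Proof. by rewrite /count_at !(psumS g) lerBrDl ltrBlDl. Qed.

(** After its first point, the renewal process starts afresh with the
    remaining gaps. *)
Lemma count_pathS g t K l :
  count_path g t K.+1 l = count_path (fun j => g j.+1) (t - g 0%N) K l.
Proof.
elim: l t K => [|[d k] l IH] t K /=; rewrite count_atS// IH.
by rewrite addrAC.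
Qed.

Lemma count_at0 g t : 0 <= t -> count_at g t 0 = (t < g 0%N).
Proof. by move=> t0; rewrite /count_at /psum big_ord0 big_ord1 t0. Qed.

Lemma count_path_at g t K l : count_path g t K l -> count_at g t K.
Proof. by case: l => [|dk l] /= /andP[]. Qed.

Lemma count_path_neg g t K l : (forall j, 0 <= g j) -> t < 0 -> count_path g t K l = false.
Proof.
move=> g0 t0; apply/negP => /count_path_at.
by rewrite /count_at (lt_geF (lt_le_trans t0 (psum_ge0 K g0))).
Qed.

Lemma measurable_psum dd (T : measurableType dd) (g : T -> nat -> R) n :
  (forall j, measurable_fun setT (g ^~ j)) -> measurable_fun setT (fun x => psum (g x) n).
Proof. by move=> mg; apply: measurable_sum. Qed.

Lemma measurable_count_path dd (T : measurableType dd) (g : T -> nat -> R)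
    (f : T -> R) K l :
  (forall j, measurable_fun setT (g ^~ j)) -> measurable_fun setT f ->
  measurable_fun setT (fun x => count_path (g x) (f x) K l).
Proof.
move=> mg; elim: l f K => [|[d k] l IH] f K mf /=.
  apply: measurable_and => //; apply: measurable_and.
    by apply: measurable_fun_ler => //; exact: measurable_psum.
  by apply: measurable_fun_ltr => //; exact: measurable_psum.
apply: measurable_and; last by apply: IH; exact: measurable_funD.
apply: measurable_and.
  by apply: measurable_fun_ler => //; exact: measurable_psum.
by apply: measurable_fun_ltr => //; exact: measurable_psum.
Qed.

(** For [u] in ]0, 1[ this inverts the tail of the exponential law; the value
    elsewhere only makes every gap positive. *)
Definition exp_gap (u : R) : R := if 0 < u < 1 then - ln u else 1.

Definition gaps (w : R) (j : nat) : R := exp_gap (evens (iter j (@odds R) w)).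

Lemma exp_gap_gt0 u : 0 < exp_gap u.
Proof. by rewrite /exp_gap; case: ifP => // u01; rewrite oppr_gt0 ln_lt0. Qed.

Lemma gaps_gt0 w j : 0 < gaps w j.
Proof. exact: exp_gap_gt0. Qed.

Lemma gapsS w j : gaps w j.+1 = gaps (odds w) j.
Proof. by rewrite /gaps iterSr. Qed.

Lemma measurable_exp_gap : measurable_fun setT exp_gap.
Proof.
apply: measurable_fun_if => //.
  by apply: measurable_and; exact: measurable_fun_ltr.
apply: measurable_funTS; apply: measurableT_comp => //; exact: measurable_ln.
Qed.

Lemma measurable_gaps j : measurable_fun setT (gaps ^~ j).
Proof.
apply: measurableT_comp; first exact: measurable_exp_gap.
apply: measurableT_comp; first exact: measurable_evens.
elim: j => [|j IH] /=; first exact: measurable_id.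
by apply: measurableT_comp IH; exact: measurable_odds.
Qed.

Lemma integral_unif_oo (f : R -> \bar R) :
  measurable_fun setT f -> (forall x, 0 <= f x)%E ->
  (\int[unif R]_x f x = \int[lebesgue_measure]_(x in `]0%R, 1%R[) f x)%E.
Proof.
move=> mf f0; rewrite /unif integral_uniform// subr0 invr1 mul1e.
by apply: integral_itv_bndoo; exact: measurable_funTS.
Qed.

Lemma integral_derive (f F : R -> R) (a b : R) : a < b ->
  (forall x, a <= x <= b -> {for x, continuous f}) ->
  (forall x, a <= x <= b -> derivable F x 1 /\ derive1 F x = f x) ->
  (\int[lebesgue_measure]_(x in `[a, b]) (f x)%:E = (F b - F a)%:E)%E.
Proof.
move=> ab cf dF.
have cF x : a <= x <= b -> {for x, continuous F}.
  by move=> /dF[h _]; exact/differentiable_continuous/derivable1_diffP.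
rewrite (continuous_FTC2 (F := F))//.
- apply: continuous_in_subspaceT => x; rewrite inE/= in_itv/=; exact: cf.
- split.
  + move=> x; rewrite in_itv/= => /andP[/ltW ax /ltW xb].
    by have [] := dF x; rewrite ?ax.
  + by apply: cvg_at_right_filter; apply: cF; rewrite lexx ltW.
  + by apply: cvg_at_left_filter; apply: cF; rewrite lexx ltW.
- move=> x; rewrite in_itv/= => /andP[/ltW ax /ltW xb].
  by have [] := dF x; rewrite ?ax.
Qed.

(** The first point falls at [- ln u], in ]t, t + d], and [k] points follow in
    the remaining time; [(t + d + ln u) ^+ k.+1] is a primitive up to a
    factor. *)
Lemma integral_pois t d k : 0 <= t -> 0 <= d ->
  (\int[lebesgue_measure]_(u in `[expR (- (t + d)), expR (- t)])
     (pois (t + d + ln u) k)%:E = (expR (- t) * pois d k.+1)%:E)%E.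
Proof.
move=> t0; rewrite le_eqVlt => /predU1P[<-|d0].
  by rewrite addr0 set_itv1 integral_set1 /pois expr0n/= mul0r !mulr0.
set c := expR (- (t + d)).
have c0 : 0 < c by exact: expR_gt0.
pose f (u : R) := c * (u^-1 * ((t + d + ln u) ^+ k / k`!%:R)).
transitivity (\int[lebesgue_measure]_(u in `[c, expR (- t)]) (f u)%:E)%E.
  apply: eq_integral => u; rewrite inE/= in_itv/= => /andP[cu _].
  have u0 : u \is Num.pos by rewrite posrE (lt_le_trans c0).
  by rewrite /f /pois (opprD (t + d)) expRD -/c (expRN (ln u)) (lnK u0) !mulrA.
pose F u : R := c * ((t + d + ln u) ^+ k.+1 / k.+1`!%:R).
rewrite (integral_derive (F := F)).
- rewrite /F /c !expRK.
  congr EFin; rewrite /pois subrr expr0n/= mul0r mulr0 subr0.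
  by rewrite (_ : t + d - t = d) ?opprD ?expRD -?mulrA//; lra.
- by rewrite ltr_expR; lra.
- move=> u /andP[cu _]; have u0 := lt_le_trans c0 cu.
  have cln : {for u, continuous (@ln R)} by exact: continuous_ln.
  apply: continuousM; first exact: cst_continuous.
  apply: continuousM.
    by apply: continuousV; [rewrite gt_eqF|].
  apply: continuousM; last exact: cst_continuous.
  apply: (@continuous_comp _ _ _ (fun u => t + d + ln u) (fun x => x ^+ k)).
    by apply: continuousD => //; exact: cst_continuous.
  exact: exprn_continuous.
move=> u /andP[cu _]; have u0 := lt_le_trans c0 cu.
have dln := is_derive1_ln u0.
suff dF : is_derive u 1 F (f u) by split; [exact: ex_derive|rewrite derive1E; exact: derive_val].
have d1 : is_derive u 1 (cst (t + d) + @ln R) (0 + u^-1) by exact: is_deriveD.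
have d2 := @is_deriveX _ _ _ k.+1 _ _ _ d1.
have d3 := @is_deriveZ _ _ _ _ (c / k.+1`!%:R) _ _ _ d2.
have -> : F = (c / k.+1`!%:R) \*: ((cst (t + d) + @ln R) ^+ k.+1).
  by apply/funext => v; rewrite /F /= fctE /GRing.scale/= mulrCA mulrC mulrAC -mulrA.
apply: is_derive_eq d3 _.
rewrite /f/= add0r /GRing.scale/= factS natrM invfM.
have k0 : (k.+1%:R : R) != 0 by rewrite pnatr_eq0.
have kf : (k`!%:R : R) != 0 by rewrite pnatr_eq0 -lt0n fact_gt0.
rewrite (_ : (cst (t + d) + @ln R) u = t + d + ln u)//.
move: (k.+1%:R : R) (k`!%:R : R) k0 kf => K K' K0 K'0.
by field; rewrite K0 K'0 gt_eqF.
Qed.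

Lemma ltr_Nln (t u : R) : 0 < u -> (t < - ln u) = (u < expR (- t)).
Proof. by move=> u0; rewrite ltrNr -[in RHS](lnK (x := u)) ?posrE// ltr_expR. Qed.

Lemma ler_Nln (t u : R) : 0 < u -> (- ln u <= t) = (expR (- t) <= u).
Proof. by move=> u0; rewrite leNgt ltr_Nln// -leNgt. Qed.

Lemma measurable_pois k : measurable_fun setT (pois ^~ k).
Proof.
apply: measurable_funM.
  by apply: measurableT_comp => //; exact: measurableT_comp.
by apply: measurable_funM.
Qed.

Lemma measurable_bool_set dd (T : measurableType dd) (f : T -> bool) :
  measurable_fun setT f -> measurable [set x | f x].
Proof.
move=> mf; have := mf measurableT [set true] (@I : measurable [set true]).
by rewrite setTI.
Qed.

(** Condition on the first gap: it is a function of [evens w], whereas the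
    following gaps are functions of [odds w]. *)
Lemma unif_first_gap K l C t d : 0 <= C -> 0 <= t -> 0 <= d ->
  (forall t, 0 <= t -> unif R [set w | count_path (gaps w) t K l] = (pois t K * C)%:E) ->
  unif R [set w | (t < gaps w 0) && count_path (gaps w) (t + d) K.+1 l] =
    (expR (- t) * pois d K.+1 * C)%:E.
Proof.
move=> C0 t0 d0 H.
pose X := [set x : measurableTypeR R * measurableTypeR R | (t < exp_gap x.1) && count_path (gaps x.2) (t + d - exp_gap x.1) K l].
have mg1 : measurable_fun setT (fun x : measurableTypeR R * measurableTypeR R => exp_gap x.1).
  by apply: measurableT_comp; [exact: measurable_exp_gap|exact: measurable_fst].
have mX : measurable X.
  apply: measurable_bool_set; apply: measurable_and; first exact: measurable_fun_ltr.
  apply: measurable_count_path; last exact: measurable_funB.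
  move=> j; apply: (measurableT_comp (measurable_gaps j)); exact: measurable_snd.
have -> : [set w | (t < gaps w 0) && count_path (gaps w) (t + d) K.+1 l] =
    [set w | X (evens w, odds w)].
  apply/seteqP; split => w /=; rewrite count_pathS -[gaps w 0]/(exp_gap (evens w));
  by rewrite (_ : (fun j => gaps w j.+1) = gaps (odds w))//; apply/funext => j; rewrite gapsS.
rewrite unif_split//.
pose h u := if t < exp_gap u <= t + d then (pois (t + d - exp_gap u) K * C)%:E else 0%E.
transitivity (\int[unif R]_u h u)%E.
  apply: eq_integral => u _ /=; rewrite /h xsectionE/=.
  case: ifPn => [/andP[tu ud]|].
    rewrite -H ?subr_ge0//; congr (unif R _).
    by apply/seteqP; split => v; rewrite /X/= tu.
  move=> tu; rewrite [X in unif R X](_ : _ = set0) ?measure0//.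
  apply/seteqP; split => v //; rewrite /X/= => /andP[tu']; move: tu; rewrite tu'/= -ltNge => ud.
  rewrite count_path_neg ?subr_lt0// => j; exact/ltW/gaps_gt0.
have mh : measurable_fun setT h.
  apply: measurable_fun_if => //.
  - apply: measurable_and; first by apply: measurable_fun_ltr => //; exact: measurable_exp_gap.
    by apply: measurable_fun_ler => //; exact: measurable_exp_gap.
  - apply/measurable_EFinP; apply: measurable_funM => //; apply: measurable_funTS.
    apply: (measurableT_comp (measurable_pois K)); apply: measurable_funB => //.
    exact: measurable_exp_gap.
rewrite integral_unif_oo//; last first.
  move=> u; rewrite /h; case: ifP => // /andP[_ ud].
  by rewrite lee_fin mulr_ge0// pois_ge0// subr_ge0.
pose f (u : R) := pois (t + d + ln u) K.
have mf : measurable_fun setT f.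
  by apply: (measurableT_comp (measurable_pois K)); apply: measurable_funD => //; exact: measurable_ln.
transitivity (\int[lebesgue_measure]_(u in `[expR (- (t + d)), expR (- t)[) (C%:E * (f u)%:E))%E.
  rewrite integral_mkcond [RHS]integral_mkcond; apply: eq_integral => u _.
  rewrite !patchE; case: ifPn.
    rewrite inE/= in_itv/= => u01; rewrite /h /exp_gap u01; case/andP: u01 => u0 u1.
    rewrite ltr_Nln// ler_Nln// andbC.
    case: ifPn => [h1|h1].
      by rewrite mem_set// EFinM muleC opprK.
    by rewrite memNset//= in_itv/=; apply/negP.
  rewrite notin_setE/= in_itv/= => u01.
  rewrite memNset//= in_itv/= => /andP[u1 u2]; apply: u01.
  rewrite (lt_le_trans (expR_gt0 _) u1) (lt_le_trans u2)// -expR0 ler_expR; lra.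
rewrite integral_itv_bndo_bndc//; last first.
  by apply: measurable_funTS; apply: measurable_funeM; exact/measurable_EFinP.
rewrite ge0_integralZl//.
- by rewrite integral_pois// -EFinM mulrC.
- by apply: measurable_funTS; exact/measurable_EFinP.
- move=> u; rewrite /= in_itv/= => /andP[u1 _]; rewrite lee_fin pois_ge0//.
  have u0 := lt_le_trans (expR_gt0 _) u1.
  by move: u1; rewrite -ler_Nln//; lra.
Qed.

Lemma unif_gap_tail t : 0 <= t -> unif R [set w | t < gaps w 0] = (expR (- t))%:E.
Proof.
move=> t0; pose A := [set u | t < exp_gap u].
have mA : measurable A.
  by apply: measurable_bool_set; apply: measurable_fun_ltr => //; exact: measurable_exp_gap.
have -> : [set w | t < gaps w 0] = (@evens R) @^-1` A `&` (@odds R) @^-1` setT.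
  by rewrite preimage_setT setIT.
rewrite unif_evens_odds// unif_setT mule1.
have -> : unif R A = (\int[unif R]_u (\1_A u)%:E)%E by rewrite integral_indic// setIT.
rewrite integral_unif_oo//; last first.
  by apply/measurable_EFinP; exact: measurable_indic.
rewrite (_ : (expR (- t))%:E = lebesgue_measure `]0, expR (- t)[%classic); last first.
  by rewrite lebesgue_measure_itv/= lte_fin expR_gt0 -EFinB subr0.
rewrite integral_indic//; congr lebesgue_measure.
apply/seteqP; split => u; rewrite /A /= !in_itv/=.
  by move=> [tu u01]; move: tu; rewrite /exp_gap u01; case/andP: u01 => u0 _; rewrite ltr_Nln// u0.
move=> /andP[u0 ut].
have u1 : u < 1 by rewrite (lt_le_trans ut)// -expR0 ler_expR; lra.
by rewrite /exp_gap u0 u1/= ltr_Nln.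
Qed.

(** A block without points is merged with the preceding silence; otherwise the
    first gap ends in the block and [unif_first_gap] leaves one point less to
    count. *)
Lemma unif_count_path K t l : 0 <= t -> all (fun dk => 0 <= dk.1) l ->
  unif R [set w | count_path (gaps w) t K l] =
    (pois t K * \prod_(dk <- l) pois dk.1 dk.2)%:E.
Proof.
elim: l K t => [|[d k] l IH] K t t0.
  move=> _; rewrite big_nil; elim: K t t0 => [|K IH] t t0.
    rewrite mulr1 /pois expr0 fact0 divr1 mulr1 -unif_gap_tail//.
    by congr (unif R _); apply/seteqP; split => w /=; rewrite andbT count_at0.
  have := @unif_first_gap K [::] 1 0 t ler01 (lexx 0) t0.
  rewrite oppr0 expR0 mul1r add0r => <-//.
  by congr (unif R _); apply/seteqP; split => w; rewrite /= gaps_gt0.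
move=> /= /andP[d0 l0]; rewrite big_cons /=.
set C := \prod_(j <- l) _.
have C0 : 0 <= C.
  rewrite /C big_seq; apply: prodr_ge0 => j jl; apply: pois_ge0.
  by move/allP : l0 => /(_ _ jl).
elim: K t t0 => [|K IHK] t t0.
  case: k => [|k].
    transitivity (unif R [set w | count_path (gaps w) (t + d) 0 l]).
      congr (unif R _); apply/seteqP; split => w /=; first by case/andP.
      move=> h; rewrite addn0 h andbT; move/count_path_at : h.
      by rewrite !count_at0 ?addr_ge0//; apply: le_lt_trans; rewrite lerDl.
    by rewrite IH ?addr_ge0// /pois !expr0 opprD expRD fact0 divr1 !mulr1 mulrA.
  transitivity (unif R [set w | (t < gaps w 0) && count_path (gaps w) (t + d) k.+1 l]).
    by congr (unif R _); apply/seteqP; split => w /=; rewrite add0n count_at0.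
  rewrite (unif_first_gap C0)//; first by rewrite -mulrA /pois expr0 fact0 divr1 mulr1.
  by move=> t' t'0; rewrite IH.
have := @unif_first_gap K ((d, k) :: l) (pois d k * C) 0 t _ (lexx 0) t0.
rewrite oppr0 expR0 mul1r add0r => <-//; last by rewrite mulr_ge0// pois_ge0.
by congr (unif R _); apply/seteqP; split => w; rewrite /= gaps_gt0.
Qed.

(** The points of the renewal process do not accumulate. *)
Definition unbounded g := forall n : nat, exists k, n%:R < psum g k.

Lemma psum_nd g m n : (forall j, 0 < g j) -> (m <= n)%N -> psum g m <= psum g n.
Proof.
move=> g0 /subnK <-; elim: (n - m)%N => [|k IH] //; rewrite addSn.
by rewrite {2}/psum big_ord_recr/= (le_trans IH)// lerDl ltW.
Qed.

Lemma count_at_le g s t K K' : (forall j, 0 < g j) -> s <= t ->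
  count_at g s K -> count_at g t K' -> (K <= K')%N.
Proof.
move=> g0 st /andP[sK _] /andP[_ tK']; rewrite leqNgt; apply/negP => KK'.
by have := lt_le_trans tK' (le_trans (psum_nd g0 KK') (le_trans sK st)); rewrite ltxx.
Qed.

Lemma count_at_ex g t : unbounded g -> 0 <= t -> exists K, count_at g t K.
Proof.
move=> ug t0; have ex : exists k, t < psum g k.
  have [k hk] := ug (Num.truncn t).+1; exists k; exact: lt_trans (truncnS_gt t) hk.
case: (ex_minnP ex) => -[|k] hk mk.
  by move: hk; rewrite /psum big_ord0 ltNge t0.
exists k; rewrite /count_at hk andbT leNgt; apply/negP => /mk.
by rewrite ltnn.
Qed.

Definition counter g t : nat := xget 0%N [set K | count_at g t K].

Lemma counterP g t K : (forall j, 0 < g j) -> unbounded g -> 0 <= t ->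
  (counter g t = K) <-> count_at g t K.
Proof.
move=> g0 ug t0; have [K0 K0P] := count_at_ex ug t0.
have cP : count_at g t (counter g t) by exact: (@xgetPex _ 0%N [set K | count_at g t K] (ex_intro _ K0 K0P)).
split=> [<-//|h]; apply/eqP; rewrite eqn_leq.
by rewrite (count_at_le g0 (lexx t) cP h) (count_at_le g0 (lexx t) h cP).
Qed.

Lemma counter_neg g t : (forall j, 0 < g j) -> t < 0 -> counter g t = 0%N.
Proof.
move=> g0 t0; apply: xgetPN => K /andP[h _].
by move: (le_lt_trans h t0); rewrite ltNge psum_ge0// => j; exact: ltW.
Qed.

Lemma count_path_counter g (t : nat -> R) (k : nat -> nat) a m K :
  (forall j, 0 < g j) -> unbounded g ->
  (forall i, 0 <= t i) ->
  count_path g (t a) K [seq (t i.+1 - t i, k i) | i <- iota a m] <->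
  counter g (t a) = K /\
  forall i, (a <= i < a + m)%N -> counter g (t i.+1) = (counter g (t i) + k i)%N.
Proof.
move=> g0 ug t0; elim: m a K => [|m IH] a K /=.
  rewrite andbT -counterP//; split=> [->|[]//]; split=> // i.
  by rewrite addn0 ltnNge; case/andP => ->.
rewrite [t a + _]addrC subrK; split.
  move=> /andP[hK /IH[h1 h2]].
  have {}hK : counter g (t a) = K by apply/counterP.
  split=> // i /andP[]; rewrite leq_eqVlt => /predU1P[<- _|ai ib].
    by rewrite h1 hK.
  by apply: h2; rewrite ai addSnnS.
move=> [h1 h2]; apply/andP; split; first exact/counterP.
apply/IH; split.
  by rewrite h2 ?leqnn ?addnS ?ltnS ?leq_addr// h1.
by move=> i /andP[ai ib]; apply: h2; rewrite ltnW//= -addSnnS.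
Qed.

Lemma poisson_probE t k : 0 <= t -> poisson_prob t 0%N [set k] = (pois t k)%:E.
Proof.
rewrite /poisson_prob le_eqVlt => /predU1P[<-|t0].
  rewrite ltxx /pois oppr0 expR0 mul1r diracE.
  case: k => [|k]; first by rewrite mem_set// expr0 fact0 divr1.
  by rewrite memNset// expr0n/= mul0r.
rewrite t0 esum_set1 ?lee_fin ?poisson_pmf_ge0//.
by rewrite /poisson_pmf t0 mulrC.
Qed.

Lemma sum_pois t : 0 <= t -> (\sum_(0 <= k <oo) (pois t k)%:E = 1)%E.
Proof.
move=> t0; rewrite -(@probability_setT _ _ _ (poisson_prob t 0%N)).
rewrite (_ : setT = \bigcup_k [set k]); last by apply/seteqP; split=> // k _; exists k.
rewrite measure_bigcup//; last by move=> i j _ _ [k [<- <-]].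
rewrite (@eq_eseriesl _ (fun k => k \in setT) xpredT); last by move=> k; rewrite in_setT.
by apply: eq_eseriesr => k _; rewrite -poisson_probE.
Qed.

(** The event that the points do not accumulate has probability 1, but a
    counting process has to be finite everywhere: off this event all gaps are
    reset to 1. *)
Definition diverging : set R := [set w | unbounded (gaps w)].

Definition safe_gaps w j : R := if pselect (diverging w) then gaps w j else 1.

Lemma safe_gaps_gt0 w j : 0 < safe_gaps w j.
Proof. by rewrite /safe_gaps; case: pselect => h; [exact: gaps_gt0|exact: ltr01]. Qed.

Lemma safe_gaps_unbounded w : unbounded (safe_gaps w).
Proof.
rewrite /safe_gaps; case: pselect => [//|h] n; exists n.+1.
by rewrite /psum sumr_const card_ord ltr_nat.
Qed.

Lemma measurable_diverging : measurable diverging.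
Proof.
have -> : diverging = \bigcap_n \bigcup_k [set w | n%:R < psum (gaps w) k].
  apply/seteqP; split => w.
    by move=> wg n _; have [k] := wg n; exists k.
  by move=> h n; have [k _] := h n I; exists k.
apply: bigcapT_measurable => n; apply: bigcupT_measurable => k.
apply: measurable_bool_set; apply: measurable_fun_ltr => //.
by apply: measurable_psum; exact: measurable_gaps.
Qed.

Lemma measurable_safe_gaps j : measurable_fun setT (safe_gaps ^~ j).
Proof.
have -> : safe_gaps ^~ j = (fun w => if w \in diverging then gaps w j else 1).
  apply/funext => w; rewrite /safe_gaps; case: pselect => h.
    by rewrite mem_set.
  by rewrite memNset.
apply: measurable_fun_if => //.
- apply: (measurable_fun_bool true); rewrite setTI.
  rewrite (_ : _ @^-1` _ = diverging); first exact: measurable_diverging.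
  by apply/seteqP; split=> w /=; [move/set_mem|move/mem_set].
- by apply: measurable_funTS; exact: measurable_gaps.
Qed.

(** Up to each time [n] the number of points is finite almost surely, since
    its Poisson masses have sum 1. *)
Lemma unif_not_diverging : unif R (~` diverging) = 0%E.
Proof.
pose B (n : nat) := ~` \bigcup_K [set w | count_path (gaps w) n%:R K [::]].
have mC n K : measurable [set w | count_path (gaps w) n%:R K [::]].
  apply: measurable_bool_set; apply: measurable_count_path => // j.
  exact: measurable_gaps.
have mU n : measurable (\bigcup_K [set w | count_path (gaps w) n%:R K [::]]).
  exact: bigcupT_measurable.
have mB n : measurable (B n) by apply: measurableC.
have B0 n : unif R (B n) = 0%E.
  suff U1 : unif R (\bigcup_K [set w | count_path (gaps w) n%:R K [::]]) = 1%E.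
    by rewrite /B (probability_setC (unif R) (mU n)) [X in (1 - X)%E]U1 subee.
  rewrite -(@sum_pois n%:R)//; etransitivity; first apply: measure_bigcup => //.
    by move=> i _; exact: mC.
    move=> i j _ _ [w [/count_path_at wi /count_path_at wj]].
    by apply/eqP; rewrite eqn_leq !(count_at_le (gaps_gt0 w) (lexx n%:R)).
  rewrite (@eq_eseriesl _ (fun k => k \in setT) xpredT); last by move=> k; rewrite in_setT.
  by apply: eq_eseriesr => k _; have /[!(big_nil, mulr1)] := @unif_count_path k n%:R [::] (ler0n _ _) isT; exact.
apply/eqP; rewrite eq_le measure_ge0 andbT.
apply: (@le_trans _ _ (unif R (\bigcup_n B n))).
  apply: le_measure; rewrite ?inE.
  - by apply: measurableC; exact: measurable_diverging.
  - exact: bigcupT_measurable.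
  move=> w /=; rewrite /diverging /= => /existsNP[n hn]; exists n => // -[K _].
  move/count_path_at => /andP[_ hK]; apply: hn; by exists K.+1.
apply: (@le_trans _ _ (\sum_(0 <= n <oo) unif R (B n))%E).
  by apply: generalized_Boole_inequality => //; exact: bigcupT_measurable.
by rewrite eseries0// => n _ _; exact: B0.
Qed.

Lemma unif_safe_count_path K t l : 0 <= t -> all (fun dk => 0 <= dk.1) l ->
  unif R [set w | count_path (safe_gaps w) t K l] =
    (pois t K * \prod_(dk <- l) pois dk.1 dk.2)%:E.
Proof.
move=> t0 l0; rewrite -unif_count_path//.
have mg : measurable [set w | count_path (gaps w) t K l].
  apply: measurable_bool_set; apply: measurable_count_path => // j; exact: measurable_gaps.
have mp : measurable [set w | count_path (safe_gaps w) t K l].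
  apply: measurable_bool_set; apply: measurable_count_path => // j; exact: measurable_safe_gaps.
have mG := measurable_diverging.
have e A : measurable A -> unif R A = unif R (A `&` diverging).
  move=> mA.
  have mI : measurable (A `&` diverging) by apply: measurableI.
  have mC : measurable (~` diverging) by apply: measurableC.
  have mD : measurable (A `&` ~` diverging) by apply: measurableI.
  have z : unif R (A `&` ~` diverging) = 0%E.
    by apply/eqP; rewrite eq_le measure_ge0 andbT -unif_not_diverging le_measure ?inE.
  rewrite -[in LHS](setIT A) -(setUv diverging) setIUr measureU//.
    by rewrite [X in (_ + X)%E]z adde0.
  by rewrite setIACA setICr setI0.
rewrite e// [RHS]e//; congr (unif R _).
have pE w : diverging w -> safe_gaps w = gaps w.
  by move=> wg; apply/funext => j; rewrite /safe_gaps; case: pselect.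
by apply/seteqP; split=> w /= [h wg]; split=> //; move: h; rewrite pE.
Qed.

Lemma measurable_counter dd (T : measurableType dd) (g : T -> nat -> R) (f : T -> R) :
  (forall x j, 0 < g x j) -> (forall x, unbounded (g x)) ->
  (forall j, measurable_fun setT (g ^~ j)) -> measurable_fun setT f ->
  (forall x, 0 <= f x) -> measurable_fun setT (fun x => counter (g x) (f x)).
Proof.
move=> g0 ug mg mf f0 _ B _; rewrite setTI.
have -> : (fun x => counter (g x) (f x)) @^-1` B =
    \bigcup_(k in B) [set x | count_path (g x) (f x) k [::]].
  apply/seteqP; split => x /=.
    move=> Bx; exists (counter (g x) (f x)) => //=.
    by rewrite andbT; apply/(counterP _ (g0 x) (ug x) (f0 x)).
  by case=> k Bk /=; rewrite andbT => /(counterP _ (g0 x) (ug x) (f0 x)) ->.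
apply: bigcup_measurable => k _; apply: measurable_bool_set.
exact: measurable_count_path.
Qed.

(** The first coordinate drives the mixing variable and the second one the
    Poisson process. *)
Definition mixing_space : Type := (measurableTypeR R * measurableTypeR R)%type.
HB.instance Definition _ := Measurable.on mixing_space.

Definition mixing_prob : probability mixing_space R := (unif R \x unif R)%E.

Lemma mixing_prob_setX A B : measurable A -> measurable B ->
  mixing_prob (A `*` B) = (unif R A * unif R B)%E.
Proof. by move=> mA mB; exact: product_measure1E. Qed.

Lemma mixing_prob_snd A : measurable A -> mixing_prob [set x | A x.2] = unif R A.
Proof.
move=> mA; rewrite (_ : [set x | A x.2] = setT `*` A); last first.
  by apply/seteqP; split=> x //= [].
by rewrite mixing_prob_setX// unif_setT mul1e.
Qed.

Definition count_process (t : R) (x : mixing_space) : nat := counter (safe_gaps x.2) t.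

Lemma measurable_count_process t : measurable_fun setT (count_process t).
Proof.
have [t0|t0] := leP 0 t.
  apply: measurable_counter => // [x j|x|j].
  - exact: safe_gaps_gt0.
  - exact: safe_gaps_unbounded.
  - by apply: (measurableT_comp (measurable_safe_gaps j)); exact: measurable_snd.
rewrite (_ : count_process t = cst 0%N)//; apply/funext => x.
by rewrite /count_process counter_neg// => j; exact: safe_gaps_gt0.
Qed.

HB.instance Definition _ t := isMeasurableFun.Build _ _ _ _ (count_process t) (measurable_count_process t).

Definition poisson_process (t : R) : {RV mixing_prob >-> nat} := count_process t.

(** Sum over the number of points before the time [t 0]. *)
Lemma count_process_law (t : nat -> R) (k : nat -> nat) m :
  0 <= t 0%N -> {homo t : i j / (i <= j)%N >-> i <= j} ->
  mixing_prob [set x | forall i, (i < m)%N -> count_process (t i.+1) x = (count_process (t i) x + k i)%N] =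
  (\prod_(i < m) pois (t i.+1 - t i) (k i))%:E.
Proof.
move=> t00 tnd; have t0 i : 0 <= t i by apply: le_trans t00 (tnd _ _ _).
pose l := [seq (t i.+1 - t i, k i) | i <- iota 0 m].
pose S := \bigcup_K [set w | count_path (safe_gaps w) (t 0%N) K l].
have mS K : measurable [set w | count_path (safe_gaps w) (t 0%N) K l].
  apply: measurable_bool_set; apply: measurable_count_path => // j; exact: measurable_safe_gaps.
have -> : [set x | forall i, (i < m)%N -> count_process (t i.+1) x = (count_process (t i) x + k i)%N] =
    [set x : mixing_space | S x.2].
  apply/seteqP; split => x /=.
    move=> h; exists (count_process (t 0%N) x) => //.
    apply/(count_path_counter _ _ _ _ (safe_gaps_gt0 _) (safe_gaps_unbounded _) t0).
    by split.
  move=> [K _ /(count_path_counter _ _ _ _ (safe_gaps_gt0 _) (safe_gaps_unbounded _) t0)[_ h]] i im.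
  by apply: h.
rewrite mixing_prob_snd; last exact: bigcupT_measurable.
pose C := \prod_(dk <- l) pois dk.1 dk.2.
have l0 : all (fun dk => 0 <= dk.1) l.
  by apply/allP => _ /mapP[i _ ->] /=; rewrite subr_ge0 tnd.
have C0 : 0 <= C.
  by rewrite /C big_map; apply: prodr_ge0 => i _; rewrite pois_ge0// subr_ge0 tnd.
have -> : \prod_(i < m) pois (t i.+1 - t i) (k i) = C.
  rewrite /C big_map -(big_mkord xpredT (fun i => pois (t i.+1 - t i) (k i))).
  by rewrite /index_iota subn0.
rewrite /S; etransitivity; first apply: measure_bigcup => //.
- by move=> i _; exact: mS.
- move=> i j _ _ [w [/count_path_at wi /count_path_at wj]].
  by apply/eqP; rewrite eqn_leq !(count_at_le (safe_gaps_gt0 w) (lexx (t 0%N))).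
rewrite (@eq_eseriesl _ (fun k => k \in setT) xpredT); last by move=> i; rewrite in_setT.
transitivity (\sum_(0 <= K <oo) (C%:E * (pois (t 0%N) K)%:E))%E.
  apply: eq_eseriesr => K _; rewrite -EFinM mulrC.
  exact: unif_safe_count_path.
rewrite nneseriesZl ?sum_pois ?mule1//.
by move=> i _; rewrite lee_fin pois_ge0.
Qed.

Lemma count_process_increment (s t : R) k : 0 <= s -> s <= t ->
  mixing_prob [set x | count_process t x = (count_process s x + k)%N] = (pois (t - s) k)%:E.
Proof.
move=> s0 st; pose u i := if i is 0%N then s else t.
have := @count_process_law u (fun=> k) 1 s0; rewrite big_ord1 => <-.
  congr (mixing_prob _); apply/seteqP; split => x /=; first by move=> h [].
  by move=> /(_ 0%N isT).
by move=> [|i] [|j] //= _.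
Qed.

Lemma poisson_process_unit : unit_poisson_process poisson_process.
Proof.
split.
- move=> w; apply/counterP => //; [exact: safe_gaps_gt0|exact: safe_gaps_unbounded|].
  by rewrite /count_at /psum big_ord0 big_ord1 lexx safe_gaps_gt0.
- move=> w s t s0 st.
  apply: (count_at_le (safe_gaps_gt0 w.2) st); apply/counterP => //.
  + exact: safe_gaps_gt0.
  + exact: safe_gaps_unbounded.
  + exact: safe_gaps_gt0.
  + exact: safe_gaps_unbounded.
  + exact: le_trans st.
- move=> w t t0; have cP u : 0 <= u -> count_at (safe_gaps w.2) u (count_process u w).
    by move=> u0; apply/counterP => //; [exact: safe_gaps_gt0|exact: safe_gaps_unbounded].
  have /andP[h1 h2] := cP t t0.
  apply: cvg_near_cst; near=> u.
  have tu : t <= u by near: u; exact: nbhs_right_ge.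
  apply/counterP; [exact: safe_gaps_gt0|exact: safe_gaps_unbounded|exact: le_trans tu|].
  apply/andP; split; first exact: le_trans tu.
  by near: u; exact: nbhs_right_lt.
- by move=> s t k s0 st; rewrite count_process_increment// poisson_probE// subr_ge0.
- move=> m t k t0 tnd; rewrite count_process_law//.
  rewrite -prodEFin; apply: eq_bigr => i _; rewrite count_process_increment//.
    by apply: le_trans t0 (tnd _ _ _).
  exact: tnd.
Unshelve. all: by end_near.
Qed.

Lemma process_sigma_algebra_snd A : process_sigma_algebra poisson_process A ->
  exists B : set (measurableTypeR R), measurable B /\ A = [set x : mixing_space | B x.2].
Proof.
apply: (@smallest_sub _ _ _ [set A | exists B : set (measurableTypeR R), measurable B /\ A = [set x : mixing_space | B x.2]]).
  split.
  - by exists set0; split.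
  - move=> _ [B [mB ->]]; exists (~` B); split; first exact: measurableC.
    by rewrite setTD.
  - move=> F /choice[G GF]; exists (\bigcup_n G n); split.
      by apply: bigcupT_measurable => n; have [] := GF n.
    by apply/seteqP; split => x [n _ h]; exists n => //; move: h; rewrite (GF n).2.
move=> _ [t [B [t0 ->]]].
exists ((fun w => counter (safe_gaps w) t) @^-1` B); split => //.
have mc : measurable_fun setT (fun w : measurableTypeR R => counter (safe_gaps w) t).
  by apply: measurable_counter => //; [exact: safe_gaps_gt0|exact: safe_gaps_unbounded|exact: measurable_safe_gaps].
by have := mc measurableT B I; rewrite setTI.
Qed.

Section mixing.
Variable q : {mfun measurableTypeR R >-> R}.
Hypothesis q_ge0 : forall u, 0 <= q u.

Definition mixing_variable (x : mixing_space) : R := q x.1.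

Lemma measurable_mixing_variable : measurable_fun setT mixing_variable.
Proof. by apply: measurableT_comp => //; exact: measurable_fst. Qed.

HB.instance Definition _ := isMeasurableFun.Build _ _ _ _ mixing_variable measurable_mixing_variable.

Lemma mixing_variable_indep : independent_of_process poisson_process (mixing_variable : {RV mixing_prob >-> R}).
Proof.
move=> A B /process_sigma_algebra_snd[A' [mA' ->]] mB.
have mqB : measurable (q @^-1` B : set (measurableTypeR R)).
  exact: measurable_funPTI.
have -> : (mixing_variable : {RV mixing_prob >-> R}) @^-1` B = [set x | (q @^-1` B) x.1] by [].
rewrite mixing_prob_snd// (_ : [set x | A' x.2] `&` _ = (q @^-1` B) `*` A'); last first.
  by apply/seteqP; split => x [].
rewrite mixing_prob_setX// muleC; congr (_ * _)%E.
rewrite (_ : [set x | (q @^-1` B) x.1] = (q @^-1` B) `*` setT); last by apply/seteqP; split => x //= [].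
by rewrite mixing_prob_setX// unif_setT mule1.
Qed.

(** Fubini: given the first coordinate, the time is fixed. *)
Lemma mixed_count_law k :
  mixing_prob [set x | count_process (mixing_variable x) x = k] = (\int[unif R]_u (pois (q u) k)%:E)%E.
Proof.
have -> : [set x | count_process (mixing_variable x) x = k] =
    [set x | count_path (safe_gaps x.2) (mixing_variable x) k [::]].
  apply/seteqP; split => x /=; rewrite andbT => /(counterP _ (safe_gaps_gt0 _) (safe_gaps_unbounded _) (q_ge0 _)); exact.
apply: eq_integral => u _ /=; rewrite xsectionE.
have := @unif_safe_count_path k (q u) [::] (q_ge0 u) isT.
by rewrite big_nil mulr1 => <-.
Qed.

End mixing.

End renewal.

(** * From Laplace transforms to mixed Poisson laws *)

Section mixed_poisson_criteria.
Variable R : realType.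
Implicit Types mu : probability (\bar R) R.

(** No mass is left outside the natural numbers. *)
Lemma nat_atoms_law mu (p : nat -> R) :
  (forall k, mu [set k%:R%:E] = (p k)%:E) -> (\sum_(0 <= k <oo) (p k)%:E = 1)%E ->
  forall A, measurable A -> mu A = (\sum_(0 <= k <oo | k%:R%:E \in A) (p k)%:E)%E.
Proof.
move=> mup p1 A mA.
pose D : set (\bar R) := \bigcup_k [set k%:R%:E].
have m1 (x : \bar R) : measurable [set x] by exact: emeasurable_set1.
have mD : measurable D by exact: bigcupT_measurable.
have tD P : trivIset P (fun k : nat => [set (k%:R%:E : \bar R)]).
  by move=> i j _ _ [x [/= -> [/eqP]]]; rewrite eqr_nat => /eqP.
have D1 : mu D = 1%E.
  rewrite /D; etransitivity; first by apply: measure_bigcup.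
  rewrite (@eq_eseriesl _ (fun k => k \in setT) xpredT); last by move=> i; rewrite in_setT.
  by rewrite -p1; apply: eq_eseriesr => k _; exact: mup.
have mCD : measurable (~` D) by exact: measurableC.
have D0 : mu (~` D) = 0%E.
  by rewrite (probability_setC mu mD) D1 subee.
have mAD : measurable (A `&` D) by exact: measurableI.
have mACD : measurable (A `&` ~` D) by exact: measurableI.
have AD0 : mu (A `&` ~` D) = 0%E.
  by apply/eqP; rewrite eq_le measure_ge0 andbT -D0 le_measure ?inE.
rewrite -[in LHS](setIT A) -(setUv D) setIUr measureU//; last first.
  by rewrite setIACA setICr setI0.
rewrite [X in (_ + X)%E]AD0 adde0.
have -> : A `&` D = \bigcup_(k in [set k | A k%:R%:E]) [set k%:R%:E].
  apply/seteqP; split => x /=; first by move=> [Ax [k _ xk]]; exists k => //=; rewrite -xk.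
  by move=> [k Ak ->]; split => //; exists k.
etransitivity; first by apply: measure_bigcup.
rewrite (@eq_eseriesl _ _ (fun k => k%:R%:E \in A)).
  by apply: eq_eseriesr => k _; exact: mup.
by move=> k; apply/idP/idP => /set_mem h; apply/mem_set.
Qed.

Lemma mixed_poisson_of_mixture mu (p : nat -> R) (q : {mfun measurableTypeR R >-> R}) :
  (forall k, mu [set k%:R%:E] = (p k)%:E) -> (\sum_(0 <= k <oo) (p k)%:E = 1)%E ->
  (forall u, 0 <= q u) ->
  (forall k, \int[unif R]_u (pois (q u) k)%:E = (p k)%:E)%E ->
  mixed_poisson mu.
Proof.
move=> mup p1 q0 qp.
exists _, (mixing_space R), (mixing_prob R), (@poisson_process R), (mixing_variable q : {RV mixing_prob R >-> R}).
split.
- exact: poisson_process_unit.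
- by move=> w; exact: q0.
- exact: mixing_variable_indep.
move=> A mA.
pose X (w : mixing_space R) : \bar R := (count_process (mixing_variable q w) w)%:R%:E.
have mX : measurable_fun setT X.
  apply/measurable_EFinP.
  have : measurable_fun setT (fun w : mixing_space R => count_process (mixing_variable q w) w).
    apply: measurable_counter => [x j|x|j||x].
    + exact: safe_gaps_gt0.
    + exact: safe_gaps_unbounded.
    + by apply: (measurableT_comp (measurable_safe_gaps j)); exact: measurable_snd.
    + exact: measurable_mixing_variable.
    + exact: q0.
  by apply: measurableT_comp.
pose XM : {RV mixing_prob R >-> \bar R} := mfun_Sub (mem_set mX).
pose nu : probability (\bar R) R := distribution (mixing_prob R) XM.
have nup k : nu [set k%:R%:E] = (p k)%:E.
  have -> : (p k)%:E = mixing_prob R [set x | count_process (mixing_variable q x) x = k].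
    by rewrite mixed_count_law.
  congr (mixing_prob R _); apply/seteqP; split => x /=.
    by move=> [/eqP]; rewrite eqr_nat => /eqP.
  by move=> <-.
have -> : mixing_prob R [set w : mixing_space R | A (count_process (mixing_variable q w) w)%:R%:E] = nu A by [].
by rewrite (nat_atoms_law mup p1 mA) (nat_atoms_law nup p1 mA).
Qed.

Implicit Types a b p : nat -> R.

Lemma series_le_lim (u : nat -> R) (l : R) n : (forall k, 0 <= u k) ->
  series u @ \oo --> l -> series u n <= l.
Proof.
move=> u0 ul; rewrite -(cvg_lim _ ul)//.
apply: nondecreasing_cvgn_le; last exact: cvgP ul.
apply: nondecreasing_series => k _ _; exact: u0.
Qed.

Lemma lim_le_eventually (u : nat -> R) (l B : R) m : u @ \oo --> l ->
  (forall n, (m <= n)%N -> u n <= B) -> l <= B.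
Proof.
move=> ul uB; rewrite -(cvg_lim _ ul)//; apply: limr_le; first exact: cvgP ul.
by exists m.
Qed.

Lemma series_geo_tail b z m n : 0 <= z < 1 -> (forall k, 0 <= b k <= 1) -> (m <= n)%N ->
  \sum_(m <= k < n) b k * z ^+ k <= z ^+ m / (1 - z).
Proof.
move=> /andP[z0 z1] b01 mn; rewrite ler_pdivlMr ?subr_gt0//.
apply: (@le_trans _ _ (z ^+ m - z ^+ n)); last by rewrite lerBlDr lerDl exprn_ge0.
rewrite -(subnK mn) addnC; elim: (n - m)%N => [|i IH].
  by rewrite addn0 big_geq// mul0r subrr.
rewrite addnS big_nat_recr/= ?leq_addr// mulrDl exprSr.
have := b01 (m + i)%N => /andP[b0 b1].
have hz : 0 <= z ^+ (m + i) by exact: exprn_ge0.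
have : b (m + i)%N * z ^+ (m + i) <= z ^+ (m + i) by rewrite ler_piMl.
have : 0 <= 1 - z by lra.
move: IH; nra.
Qed.

(** Induction on [k]: once the terms below [k] agree, divide by [z ^+ k] and
    let [z] tend to 0. *)
Lemma pgf_unique a b (f : R -> R) :
  (forall k, 0 <= a k <= 1) -> (forall k, 0 <= b k <= 1) ->
  (forall z, 0 < z < 1 -> series (fun k => a k * z ^+ k) @ \oo --> f z) ->
  (forall z, 0 < z < 1 -> series (fun k => b k * z ^+ k) @ \oo --> f z) ->
  forall k, a k = b k.
Proof.
have key c d k : (forall k, 0 <= c k <= 1) -> (forall k, 0 <= d k <= 1) ->
  (forall z, 0 < z < 1 -> series (fun k => c k * z ^+ k) @ \oo --> f z) ->
  (forall z, 0 < z < 1 -> series (fun k => d k * z ^+ k) @ \oo --> f z) ->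
  (forall j, (j < k)%N -> c j = d j) -> c k <= d k.
  move=> c01 d01 cf df cd; apply/ler_addgt0Pr => e e0.
  pose z := Num.min (2^-1) (e / 2).
  have z0 : 0 < z by rewrite lt_min invr_gt0 ltr0n/= divr_gt0.
  have z2 : z <= 2^-1 by rewrite ge_min lexx.
  have ze : z <= e / 2 by rewrite ge_min lexx orbT.
  have z1 : z < 1 by lra.
  have z01 : 0 < z < 1 by rewrite z0 z1.
  have h1 : series (fun k => c k * z ^+ k) k.+1 <= f z.
    apply: series_le_lim (cf z z01) => j; rewrite mulr_ge0 ?exprn_ge0//; last lra.
    by case/andP: (c01 j).
  have h2 : f z <= series (fun k => d k * z ^+ k) k.+1 + z ^+ k.+1 / (1 - z).
    apply: (lim_le_eventually (m := k.+1) (df z z01)) => n kn.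
    rewrite /series/= (@big_cat_nat _ _ _ k.+1)//= lerD2l.
    by apply: series_geo_tail => //; lra.
  move: (le_trans h1 h2); rewrite /series/= !big_nat_recr//=.
  rewrite (eq_big_nat _ _ (F2 := fun j => d j * z ^+ j)); last first.
    by move=> j /andP[_ jk]; rewrite cd.
  rewrite -addrA lerD2l exprS => h.
  have zk : 0 < z ^+ k by rewrite exprn_gt0.
  have : c k <= d k + z / (1 - z).
    by rewrite -(ler_pM2r zk) mulrDl (mulrAC z).
  have : z / (1 - z) <= e by rewrite ler_pdivrMr; [nra|lra].
  lra.
move=> a01 b01 af bf k; elim/ltn_ind: k => k IH.
by apply/eqP; rewrite eq_le (key a b)//= (key b a)// => j jk; rewrite IH.
Qed.

Lemma pois_le1 (t : R) k : 0 <= t -> pois t k <= 1.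
Proof.
move=> t0; rewrite -lee_fin -(sum_pois t0).
apply: le_trans (nneseries_lim_ge k.+1 _); last first.
  by move=> i _; rewrite lee_fin pois_ge0.
rewrite big_nat_recr//= leeDr// sume_ge0// => i _; by rewrite lee_fin pois_ge0.
Qed.

(** Reweighting by [z ^+ k] turns the Poisson law of rate [t] into the one of
    rate [z * t], up to normalization. *)
Lemma pois_pgf (t z : R) : 0 <= t -> 0 <= z ->
  (\sum_(0 <= k <oo) (pois t k * z ^+ k)%:E = (expR (- ((1 - z) * t)))%:E)%E.
Proof.
move=> t0 z0; transitivity (\sum_(0 <= k <oo) ((expR (- ((1 - z) * t)))%:E * (pois (z * t) k)%:E))%E.
  have e : expR (- t) = expR (- ((1 - z) * t)) * expR (- (z * t)).
    by rewrite -expRD; congr expR; ring.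
  by apply: eq_eseriesr => k _; rewrite -EFinM /pois e exprMn; congr EFin; ring.
rewrite nneseriesZl ?sum_pois ?mule1 ?mulr_ge0//.
by move=> k _; rewrite lee_fin pois_ge0 ?mulr_ge0.
Qed.

(** By [pois_pgf], both sides are power series in [1 - t] with the same sum. *)
Lemma laplace_mixture p (q : {mfun measurableTypeR R >-> R}) (h : R -> R) :
  (forall k, 0 <= p k <= 1) -> (forall u, 0 <= q u) ->
  (forall z, 0 < z < 1 -> series (fun k => p k * z ^+ k) @ \oo --> h (1 - z)) ->
  (forall t : R, 0 < t < 1 -> (\int[unif R]_u (expR (- (t * q u)))%:E = (h t)%:E)%E) ->
  forall k, (\int[unif R]_u (pois (q u) k)%:E = (p k)%:E)%E.
Proof.
move=> p01 q0 ph qh.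
have mp k : measurable_fun setT (fun u => pois (q u) k).
  by apply: (measurableT_comp (measurable_pois k)).
have ip0 k : (0 <= \int[unif R]_u (pois (q u) k)%:E)%E.
  by apply: integral_ge0 => u _; rewrite lee_fin pois_ge0.
have ip1 k : (\int[unif R]_u (pois (q u) k)%:E <= 1)%E.
  apply: (@le_trans _ _ (\int[unif R]_u 1%:E)%E).
    apply: ge0_le_integral => //.
    - by move=> u _; rewrite lee_fin pois_ge0.
    - exact/measurable_EFinP.
    - by move=> u _; rewrite lee_fin pois_le1.
  by rewrite integral_cst// mul1e; exact: probability_le1.
have ipf k : (\int[unif R]_u (pois (q u) k)%:E)%E \is a fin_num.
  by rewrite ge0_fin_numE// (le_lt_trans (ip1 k)) ?ltry.
pose pi k := fine (\int[unif R]_u (pois (q u) k)%:E)%E.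
have piE k : (\int[unif R]_u (pois (q u) k)%:E = (pi k)%:E)%E by rewrite fineK.
have pi01 k : 0 <= pi k <= 1 by rewrite -!lee_fin -piE ip0 ip1.
suff H : forall k, p k = pi k by move=> k; rewrite piE H.
apply: (pgf_unique p01 pi01 ph) => z z01.
have z0 : 0 <= z by lra.
have E : (\sum_(0 <= k <oo) (pi k * z ^+ k)%:E = (h (1 - z))%:E)%E.
  rewrite -qh; last lra.
  transitivity (\int[unif R]_u (\sum_(0 <= k <oo) (pois (q u) k * z ^+ k)%:E))%E; last first.
    by apply: eq_integral => u _; rewrite pois_pgf.
  rewrite integral_nneseries//; last 2 first.
  - by move=> k; apply/measurable_EFinP; apply: measurable_funM.
  - by move=> k u _; rewrite lee_fin mulr_ge0 ?pois_ge0 ?exprn_ge0.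
  apply: eq_eseriesr => k _.
  rewrite EFinM -piE -ge0_integralZr ?lee_fin ?exprn_ge0//.
  - exact/measurable_EFinP.
  - by move=> u _; rewrite lee_fin pois_ge0.
have : (\sum_(0 <= k < n) (pi k * z ^+ k)%:E)%E @[n --> \oo] --> (h (1 - z))%:E.
  rewrite -E; apply: is_cvg_nneseries => k _ _.
  by rewrite lee_fin mulr_ge0 ?exprn_ge0//; case/andP: (pi01 k).
under eq_fun do rewrite sumEFin.
by move/fine_cvgP => [_].
Qed.

End mixed_poisson_criteria.

(** * A selection theorem for Laplace transforms *)

Section quantile_transform.
Variable R : realType.

Lemma bool_indic (T : Type) (f : T -> bool) :
  (fun u => (f u)%:R : R) = \1_[set u | f u].
Proof.
apply/funext => u; rewrite indicE; congr (_%:R); congr nat_of_bool.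
by apply/idP/idP => [h|/set_mem//]; exact/mem_set.
Qed.

Lemma measurable_bool_fun dd (T : measurableType dd) (f : T -> bool) :
  measurable_fun setT f -> measurable_fun setT (fun u => (f u)%:R : R).
Proof.
by move=> mf; rewrite bool_indic; apply: measurable_indic; exact: measurable_bool_set.
Qed.

Lemma unif_ge1 : unif R `[1, +oo[%classic = 0%E.
Proof.
rewrite unifE// (_ : _ `&` _ = [set 1]) ?lebesgue_measure_set1//.
apply/seteqP; split => y /=; rewrite !in_itv/= andbT.
  by move=> [y1 /andP[_ y2]]; apply/eqP; rewrite eq_le y1 y2.
by move=> ->; rewrite lexx ler01.
Qed.

Lemma unif_le g : 0 <= g <= 1 -> unif R `]-oo, g]%classic = g%:E.
Proof.
move=> /andP[g0 g1]; rewrite unifE// (_ : _ `&` _ = `[0, g]%classic).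
  by rewrite lebesgue_measure_itv/= lte_fin -EFinB subr0; case: ltP => // g0'; congr EFin; lra.
apply/seteqP; split => y /=; rewrite !in_itv/=.
  by move=> [-> /andP[-> _]].
by move=> /andP[-> yg]; rewrite yg (le_trans yg g1).
Qed.

(** The distribution of [quantile G] under the uniform law is [G], up to the
    values at its jumps: [G] is only monotone, hence the two one-sided bounds
    [unif_quantile_lt] and [unif_quantile_le]. *)
Section quantile.
Variable G : R -> R.
Hypothesis G01 : forall a, 0 <= G a <= 1.
Hypothesis G_nd : forall a b, a <= b -> G a <= G b.
Hypothesis G_tight : forall u, u < 1 -> exists a, u <= G a.

Let below u := [set a | a = 0 \/ 0 <= a /\ G a < u].

Let has_sup_below u : u < 1 -> has_sup (below u).
Proof.
move=> u1; split; first by exists 0; left.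
have [b ub] := G_tight u1; exists (Num.max 0 b) => a [->|[_ au]].
  by rewrite le_max lexx.
rewrite le_max; apply/orP; right; rewrite leNgt; apply/negP => /ltW/G_nd.
by rewrite leNgt (lt_le_trans au ub).
Qed.

Definition quantile u : R := if 0 < u < 1 then sup (below u) else 0.

Lemma quantile_ge0 u : 0 <= quantile u.
Proof.
rewrite /quantile; case: ifP => // /andP[_ u1].
by apply: sup_upper_bound; [exact: has_sup_below|left].
Qed.

Lemma quantile_lt a u : 0 <= a -> 0 < u < 1 -> quantile u < a -> u <= G a.
Proof.
move=> a0 u01; rewrite /quantile u01; case/andP: u01 => u0 u1 qa.
rewrite leNgt; apply/negP => Ga; move: qa; rewrite ltNge => /negP; apply.
by apply: sup_upper_bound; [exact: has_sup_below|right].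
Qed.

Lemma quantile_le a u : 0 <= a -> 0 < u < 1 -> u <= G a -> quantile u <= a.
Proof.
move=> a0 u01 ua; rewrite /quantile u01; case/andP: u01 => u0 u1.
apply: ge_sup; first by exists 0; left.
move=> b [->//|[b0 bu]]; rewrite leNgt; apply/negP => /ltW/G_nd.
by rewrite leNgt (lt_le_trans bu ua).
Qed.

Lemma measurable_quantile : measurable_fun setT quantile.
Proof.
apply: measurable_fun_if => //.
  by apply: measurable_and; exact: measurable_fun_ltr.
rewrite setTI (_ : _ @^-1` _ = `]0, 1[%classic); last first.
  by apply/seteqP; split=> u /=; rewrite in_itv.
apply: (measurability (@RGenCInfty.G R)) => [|/= _ [_] [r'] -> <-].
  exact: RGenCInfty.measurableE.
apply: is_interval_measurable => u v /=; rewrite !in_itv/= !andbT.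
move=> [/andP[u0 u1] ru] [/andP[v0 v1] rv] w0 /andP[uw wv].
have w1 := le_lt_trans wv v1.
rewrite !in_itv/= andbT; split; first by rewrite (lt_le_trans u0 uw).
apply: le_trans ru _; apply: sup_le; [|by exists 0; left|exact: has_sup_below].
move=> a [->|[a0 au]]; first by exists 0; split; [left|].
by exists a; split => //; right; split => //; exact: lt_le_trans uw.
Qed.

Let mlt a : measurable [set u | quantile u < a].
Proof. by apply: measurable_bool_set; apply: measurable_fun_ltr => //; exact: measurable_quantile. Qed.

Let mle a : measurable [set u | quantile u <= a].
Proof. by apply: measurable_bool_set; apply: measurable_fun_ler => //; exact: measurable_quantile. Qed.

Lemma unif_quantile_lt a : 0 <= a -> (unif R [set u | (quantile u < a)%R] <= (G a)%:E)%E.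
Proof.
move=> a0; rewrite -unif_le// -[leRHS]adde0 -[X in (_ + X)%E]unif_ge1.
apply: (@le_trans _ _ (unif R (`]-oo, G a] `|` `[1%R, +oo[))%E).
  apply: le_measure; rewrite ?inE//; first exact: mlt.
    by apply: measurableU.
  move=> u /= qa; rewrite !in_itv/= andbT; case: (leP 1 u) => u1; [by right|left].
  have [u0|u0] := leP u 0; first by rewrite (le_trans u0)//; case/andP: (G01 a).
  by apply: quantile_lt => //; rewrite u0.
exact: measureU2.
Qed.

Lemma unif_quantile_le a : 0 <= a -> ((G a)%:E <= unif R [set u | (quantile u <= a)%R])%E.
Proof.
move=> a0; rewrite -unif_le// -[leRHS]adde0 -[X in (_ + X)%E]unif_ge1.
apply: (@le_trans _ _ (unif R ([set u | (quantile u <= a)%R] `|` `[1%R, +oo[))%E).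
  apply: le_measure; rewrite ?inE//.
    by apply: measurableU => //; exact: mle.
  move=> u /=; rewrite !in_itv/= andbT => uG; case: (leP 1 u) => u1; [by right|left].
  have [u0|u0] := leP u 0; last by apply: quantile_le => //; rewrite u0.
  by rewrite /quantile ltNge u0.
by apply: measureU2 => //; exact: mle.
Qed.

End quantile.

End quantile_transform.

(** An ultrafilter contains the preimage of a neighbourhood or that of its
    complement, and the latter is impossible at a cluster point. *)
Lemma ultra_bounded_cvg (R : realType) (I : Type) (U : set_system I) (f : I -> R) (a b : R) :
  UltraFilter U -> (forall i, a <= f i <= b) -> exists l : R, f @ U --> l.
Proof.
move=> UU fab; have FU : ProperFilter (f @ U) by exact: fmap_proper_filter.
have [|l [_ cl]] := @segment_compact R a b (f @ U) FU.
  have : U (f @^-1` `[a, b]%classic); last by [].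
  by apply: filterE => i; rewrite /= in_itv/= fab.
exists l => V Vl; have [//|VC] := @in_ultra_setVsetC _ U (f @^-1` V) UU.
by have [x [/= nVx]] := cl (~` V) V VC Vl.
Qed.

Section laplace_limit.
Variable R : realType.
Implicit Types (w y : R).

Lemma count_le_ge0 (n : nat) w : 0 <= w -> \sum_(j < n) (j.+1%:R <= w)%R%:R <= w.
Proof.
move=> w0; elim: n => [|n IH]; first by rewrite big_ord0.
rewrite big_ord_recr/=; case: (leP n.+1%:R w) => h; last by rewrite addr0.
apply: le_trans h; rewrite -natr1 lerD2r (@le_trans _ _ (\sum_(j < n) 1))//.
  by apply: ler_sum => j _; case: (j.+1%:R <= w); rewrite ?ler01.
by rewrite sumr_const card_ord.
Qed.

Lemma count_lt_lb (n : nat) w : w <= n%:R -> w <= \sum_(j < n) (j.+1%:R < w)%R%:R + 1.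
Proof.
elim: n w => [|n IH] w wn; first by rewrite big_ord0; lra.
rewrite big_ord_recr/=; have [h|h] := leP w n%:R.
  by rewrite (le_trans (IH _ h))// addrAC lerDl.
rewrite (eq_bigr (fun=> 1)) => [|j _]; last first.
  by rewrite (le_lt_trans _ h)// ler_nat.
rewrite sumr_const card_ord; apply: (le_trans wn).
by rewrite -natr1 addrAC lerDl.
Qed.

(** The points at which [exp(- t y)] crosses the multiples of [1 / J]: the
    exponential is within [1 / J] of the step function that counts the
    thresholds above [y], uniformly in [y]. *)
Definition exp_threshold (t : R) (J j : nat) : R := - ln (j.+1%:R / J%:R) / t.

Lemma exp_threshold_ge0 t J j : 0 < t -> (j < J)%N -> 0 <= exp_threshold t J j.
Proof.
move=> t0 jJ; have J0 : (0 : R) < J%:R by rewrite ltr0n (leq_ltn_trans _ jJ).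
by rewrite divr_ge0 ?oppr_ge0 ?ln_le0 ?ler_pdivrMr ?mul1r ?ler_nat// ltW.
Qed.

Lemma le_exp_threshold t J j y : 0 < t -> (j < J)%N ->
  (y <= exp_threshold t J j) = (j.+1%:R <= J%:R * expR (- (t * y))).
Proof.
move=> t0 jJ; have J0 : (0 : R) < J%:R by rewrite ltr0n (leq_ltn_trans _ jJ).
rewrite ler_pdivlMr// mulrC lerNr -ler_expR lnK ?posrE ?divr_gt0//.
by rewrite ler_pdivrMr// (mulrC J%:R).
Qed.

Lemma lt_exp_threshold t J j y : 0 < t -> (j < J)%N ->
  (y < exp_threshold t J j) = (j.+1%:R < J%:R * expR (- (t * y))).
Proof.
move=> t0 jJ; have J0 : (0 : R) < J%:R by rewrite ltr0n (leq_ltn_trans _ jJ).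
rewrite ltr_pdivlMr// mulrC ltrNr -ltr_expR lnK ?posrE ?divr_gt0//.
by rewrite ltr_pdivrMr// (mulrC J%:R).
Qed.

Lemma step_le_exp t J y : 0 < t -> (0 < J)%N ->
  J%:R^-1 * \sum_(j < J) (y <= exp_threshold t J j)%R%:R <= expR (- (t * y)).
Proof.
move=> t0 J0; rewrite ler_pdivrMl ?ltr0n//.
under eq_bigr => j _ do rewrite le_exp_threshold//.
by apply: count_le_ge0; rewrite mulr_ge0// expR_ge0.
Qed.

Lemma exp_le_step t J y : 0 < t -> (0 < J)%N -> 0 <= y ->
  expR (- (t * y)) <= J%:R^-1 * \sum_(j < J) (y < exp_threshold t J j)%R%:R + J%:R^-1.
Proof.
move=> t0 J0 y0; have J0' : (0 : R) < J%:R by rewrite ltr0n.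
rewrite -[X in _ + X]mulr1 -mulrDr ler_pdivlMl//.
under eq_bigr => j _ do rewrite lt_exp_threshold//.
apply: count_lt_lb; rewrite ler_piMr// ?ler0n//.
by rewrite -expR0 ler_expR oppr_le0 mulr_ge0// ltW.
Qed.

Lemma ler_cvgs (I : Type) (F : set_system I) (FF : ProperFilter F) (u v : I -> R) (a b : R) :
  u @ F --> a -> v @ F --> b -> (forall i, u i <= v i) -> a <= b.
Proof.
move=> ua vb uv; rewrite -subr_ge0.
apply: (@cvgr_to_ge _ F _ _ (fun i => v i - u i)); first exact: cvgB.
by apply: nearW => i; rewrite subr_ge0.
Qed.

Lemma cvg_sum_ord (I : Type) (F : set_system I) (FF : Filter F) n
    (u : nat -> I -> R) (l : nat -> R) :
  (forall j, (j < n)%N -> u j @ F --> l j) ->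
  (fun i => \sum_(j < n) u j i) @ F --> \sum_(j < n) l j.
Proof.
elim: n => [|n IH] ul.
  under eq_fun do rewrite big_ord0.
  by rewrite big_ord0; exact: cvg_cst.
under eq_fun do rewrite big_ord_recr/=.
rewrite big_ord_recr/=; apply: cvgD; last exact: ul.
by apply: IH => j jn; apply: ul; exact: ltnW.
Qed.

Lemma cvg_series_le1 (r f : nat -> R) : (forall k, 0 <= r k) -> series r @ \oo --> (1 : R) ->
  (forall k, 0 <= f k <= 1) -> cvg (series (fun k => r k * f k) @ \oo).
Proof.
move=> r0 r1 f01; apply: nondecreasing_is_cvgn.
  by apply: nondecreasing_series => k _ _; rewrite mulr_ge0//; case/andP: (f01 k).
exists 1 => _ [n _ <-]; apply: le_trans (series_le_lim n r0 r1).
by apply: ler_sum => k _; rewrite ler_piMr//; case/andP: (f01 k).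
Qed.

Variables (r x : nat -> nat -> R) (A : nat -> R -> R) (h : R -> R).
Hypothesis r_ge0 : forall n k, 0 <= r n k.
Hypothesis r_sum1 : forall n, series (r n) @ \oo --> (1 : R).
Hypothesis x_ge0 : forall n k, 0 <= x n k.
Hypothesis A_series : forall n t, 0 < t < 1 ->
  series (fun k => r n k * expR (- (t * x n k))) @ \oo --> A n t.
Hypothesis A_cvg : forall t, 0 < t < 1 -> A ^~ t @ \oo --> h t.
Hypothesis h_tight : forall e, 0 < e -> exists2 t, 0 < t < 1 & 1 - e <= h t.

Let b01 (b : bool) : 0 <= (b%:R : R) <= 1.
Proof. by case: b; rewrite ?lexx ?ler01. Qed.

Let cdf n (a : R) : R := limn (series (fun k => r n k * (x n k <= a)%R%:R)).

Let cdf_cvg n a : series (fun k => r n k * (x n k <= a)%R%:R) @ \oo --> cdf n a.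
Proof. exact: cvg_series_le1. Qed.

Let cdf01 n a : 0 <= cdf n a <= 1.
Proof.
apply/andP; split.
  apply: (cvgr_to_ge (@cdf_cvg n a)); apply: nearW => N.
  by apply: sumr_ge0 => k _; rewrite mulr_ge0.
apply: (cvgr_to_le (@cdf_cvg n a)); apply: nearW => N.
apply: le_trans (series_le_lim N (r_ge0 n) (@r_sum1 n)).
by apply: ler_sum => k _; rewrite ler_piMr//; case/andP: (b01 (x n k <= a)).
Qed.

Let cdf_nd n a b : a <= b -> cdf n a <= cdf n b.
Proof.
move=> ab; apply: (ler_cvgs _ (@cdf_cvg n a) (@cdf_cvg n b)) => N; apply: ler_sum => k _; rewrite ler_wpM2l// ler_nat.
by case: (leP (x n k) a) => // xa; rewrite (le_trans xa ab).
Qed.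

Let cdf_step n J t : (0 < J)%N -> 0 < t < 1 ->
  J%:R^-1 * \sum_(j < J) cdf n (exp_threshold t J j) <= A n t <=
  J%:R^-1 * \sum_(j < J) cdf n (exp_threshold t J j) + J%:R^-1.
Proof.
move=> J0 t01; set s := J%:R^-1 * _; have /andP[t0 t1] := t01.
have sE : series (fun k => r n k * (J%:R^-1 * \sum_(j < J) (x n k <= exp_threshold t J j)%R%:R)) @ \oo --> s.
  have -> : series (fun k => r n k * (J%:R^-1 * \sum_(j < J) (x n k <= exp_threshold t J j)%R%:R)) =
      (fun N => J%:R^-1 * \sum_(j < J) series (fun k => r n k * (x n k <= exp_threshold t J j)%R%:R) N).
    apply/funext => N; rewrite /series/= exchange_big/= mulr_sumr.
    apply: eq_bigr => k _; rewrite mulrCA; congr (_ * _).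
    by rewrite mulr_sumr.
  by apply: cvgMr; apply: (@cvg_sum_ord _ _ _ J (fun j => series (fun k => r n k * (x n k <= exp_threshold t J j)%R%:R)) (fun j => cdf n (exp_threshold t J j))) => j _; exact: cdf_cvg.
have AE := @A_series n _ t01.
apply/andP; split.
  by apply: (ler_cvgs _ sE AE) => N; apply: ler_sum => k _; rewrite ler_wpM2l// step_le_exp.
have sE' : (fun N => series (fun k => r n k * (J%:R^-1 * \sum_(j < J) (x n k <= exp_threshold t J j)%R%:R)) N + J%:R^-1)
    @ \oo --> s + J%:R^-1 by apply: cvgD => //; exact: cvg_cst.
apply: (ler_cvgs _ AE sE') => N; apply: (@le_trans _ _ (series (fun k => r n k * (J%:R^-1 * \sum_(j < J) (x n k <= exp_threshold t J j)%R%:R)) N + J%:R^-1 * series (r n) N)).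
  rewrite /series/= mulr_sumr -big_split/=; apply: ler_sum => k _.
  rewrite [J%:R^-1 * r n k]mulrC -mulrDr ler_wpM2l//.
  apply: le_trans (exp_le_step t0 J0 (x_ge0 n k)) _.
  rewrite lerD2r ler_wpM2l ?invr_ge0 ?ler0n//; apply: ler_sum => j _.
  by rewrite ler_nat; case: (ltP (x n k) (exp_threshold t J j)) => // /ltW ->.
by rewrite lerD2l ler_piMr ?invr_ge0 ?ler0n//; exact: (series_le_lim N (r_ge0 n) (@r_sum1 n)).
Qed.

(** The distribution functions of the discrete laws with masses [r n k] at
    the points [x n k] converge at every point along an ultrafilter finer than
    [\oo]; [q] is the quantile function of their limit [G], which tends to 1
    by [h_tight]. Laplace transforms are, up to
    [1 / J], averages of distribution functions over thresholds, so they pass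
    to the limit without any continuity of [G]. *)
Theorem laplace_limit : exists q : {mfun measurableTypeR R >-> R},
  (forall u, 0 <= q u) /\
  forall t : R, 0 < t < 1 -> (\int[unif R]_u (expR (- (t * q u)))%:E = (h t)%:E)%E.
Proof.
have [U [UU oU]] := @ultraFilterLemma nat \oo _.
have UP : ProperFilter U := @ultra_proper _ U UU.
have /choice[G GE] : forall a, exists l : R, cdf ^~ a @ U --> l.
  by move=> a; apply: (@ultra_bounded_cvg _ _ _ _ 0 1) => n.
have G01 a : 0 <= G a <= 1.
  apply/andP; split; [apply: (cvgr_to_ge (GE a))|apply: (cvgr_to_le (GE a))];
    by apply: nearW => n; case/andP: (cdf01 n a).
have G_nd a b : a <= b -> G a <= G b.
  by move=> ab; apply: (ler_cvgs _ (GE a) (GE b)) => n; exact: cdf_nd.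
have hE t : 0 < t < 1 -> A ^~ t @ U --> h t.
  by move=> t01; apply: cvg_trans (A_cvg t01); exact: cvg_app.
have G_step t J : (0 < J)%N -> 0 < t < 1 ->
    J%:R^-1 * \sum_(j < J) G (exp_threshold t J j) <= h t <= J%:R^-1 * \sum_(j < J) G (exp_threshold t J j) + J%:R^-1.
  move=> J0 t01.
  have sE : (fun n => J%:R^-1 * \sum_(j < J) cdf n (exp_threshold t J j)) @ U --> J%:R^-1 * \sum_(j < J) G (exp_threshold t J j).
    by apply: cvgMr; apply: (@cvg_sum_ord _ _ _ J (fun j n => cdf n (exp_threshold t J j)) (fun j => G (exp_threshold t J j))) => j _; exact: GE.
  have sE' : (fun n => J%:R^-1 * \sum_(j < J) cdf n (exp_threshold t J j) + J%:R^-1) @ U --> J%:R^-1 * \sum_(j < J) G (exp_threshold t J j) + J%:R^-1.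
    by apply: cvgD => //; exact: cvg_cst.
  apply/andP; split; [apply: (ler_cvgs _ sE (hE _ t01))|apply: (ler_cvgs _ (hE _ t01) sE')] => n;
    by case/andP: (cdf_step n J0 t01).
have G_tight u : u < 1 -> exists a, u <= G a.
  move=> u1; have e0 : 0 < (1 - u) / 2 by lra.
  have [t t01 ht] := h_tight e0.
  have [J J0 Je] : exists2 J : nat, (0 < J)%N & J%:R^-1 <= (1 - u) / 2.
    exists (Num.truncn ((1 - u) / 2)^-1).+1 => //.
    by rewrite invf_ple ?posrE// ltW// truncnS_gt.
  exists (exp_threshold t J 0); have /andP[_ h2] := G_step _ _ J0 t01.
  have h3 : J%:R^-1 * \sum_(j < J) G (exp_threshold t J j) <= G (exp_threshold t J 0).
    rewrite ler_pdivrMl ?ltr0n// (@le_trans _ _ (\sum_(j < J) G (exp_threshold t J 0)))//.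
      apply: ler_sum => j _; apply: G_nd; case/andP: t01 => t0 _.
      have J0' : (0 : R) < J%:R by rewrite ltr0n.
      rewrite ler_pM2r ?invr_gt0// lerN2 ler_ln ?posrE ?divr_gt0//.
      by rewrite ler_pM2r ?invr_gt0// ler_nat.
    by rewrite sumr_const card_ord mulr_natl.
  lra.
have mq : measurable_fun setT (quantile G : measurableTypeR R -> R) by exact: measurable_quantile.
pose q : {mfun measurableTypeR R >-> R} := @mfun_Sub _ _ (measurableTypeR R) R _ (mem_set mq).
have q0 u : 0 <= q u by exact: quantile_ge0.
exists q; split => // t t01; have /andP[t0 t1] := t01.
set I := (\int[unif R]_u _)%E.
have mqt : measurable_fun setT (fun u : measurableTypeR R => (expR (- (t * q u)))%:E).
  apply/measurable_EFinP; apply: measurableT_comp => //; apply: measurableT_comp => //.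
  exact: measurable_funM.
have step J : (0 < J)%N -> ((J%:R^-1 * \sum_(j < J) G (exp_threshold t J j))%:E <= I)%E /\
    (I <= (J%:R^-1 * \sum_(j < J) G (exp_threshold t J j) + J%:R^-1)%:E)%E.
  move=> J0.
  have m1 (j : nat) : measurable_fun setT (fun u : measurableTypeR R => (q u <= exp_threshold t J j)%R).
    by apply: measurable_fun_ler.
  have m2 (j : nat) : measurable_fun setT (fun u : measurableTypeR R => (q u < exp_threshold t J j)%R).
    by apply: measurable_fun_ltr.
  have intE (f : nat -> measurableTypeR R -> bool) : (forall j, measurable_fun setT (f j)) ->
    (\int[unif R]_u (J%:R^-1 * \sum_(j < J) (f j u)%:R)%:E =
     J%:R^-1%:E * \sum_(j < J) unif R [set u | f j u])%E.
    move=> mf.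
    have mS (j : nat) : measurable [set u | f j u] by exact: measurable_bool_set.
    have mE (j : nat) : measurable_fun setT (fun u => (f j u)%:R : R).
      exact: measurable_bool_fun.
    under eq_integral do rewrite EFinM.
    rewrite ge0_integralZl ?lee_fin ?invr_ge0//.
    - congr (_ * _)%E; under eq_integral do rewrite -sumEFin.
      rewrite ge0_integral_sum//; last first.
        by move=> j; apply/measurable_EFinP; exact: mE.
      apply: eq_bigr => j _; transitivity (\int[unif R]_u (\1_[set u | f j u] u)%:E)%E.
        by rewrite -bool_indic.
      by rewrite integral_indic// setIT.
    - by apply/measurable_EFinP; apply: measurable_sum => j; exact: mE.
    - by move=> u _; rewrite lee_fin sumr_ge0.
  have mst (f : nat -> measurableTypeR R -> bool) : (forall j, measurable_fun setT (f j)) ->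
      measurable_fun setT (fun u => (J%:R^-1 * \sum_(j < J) (f j u)%:R : R)%:E).
    move=> mf; apply/measurable_EFinP; apply: measurable_funM => //; apply: measurable_sum => j.
    exact: measurable_bool_fun.
  have GEs : ((J%:R^-1 * \sum_(j < J) G (exp_threshold t J j))%:E = J%:R^-1%:E * \sum_(j < J) (G (exp_threshold t J j))%:E)%E.
    by rewrite sumEFin.
  have Ji0 : 0 <= J%:R^-1 :> R by rewrite invr_ge0.
  split.
    apply: (@le_trans _ _ (\int[unif R]_u (J%:R^-1 * \sum_(j < J) (q u <= exp_threshold t J j)%R%:R)%:E)%E).
      rewrite (intE (fun j u => (q u <= exp_threshold t J j)%R))// GEs lee_wpmul2l ?lee_fin//.
      by apply: lee_sum => j _; apply: unif_quantile_le => //; exact: exp_threshold_ge0.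
    apply: ge0_le_integral => //.
    - by move=> u _; rewrite lee_fin mulr_ge0// sumr_ge0.
    - exact: (mst (fun j u => (q u <= exp_threshold t J j)%R) m1).
    - by move=> u _; rewrite lee_fin step_le_exp.
  apply: (@le_trans _ _ (\int[unif R]_u ((J%:R^-1 * \sum_(j < J) (q u < exp_threshold t J j)%R%:R)%:E + J%:R^-1%:E))%E).
    apply: ge0_le_integral => //.
    - by apply: emeasurable_funD => //; exact: (mst (fun j u => (q u < exp_threshold t J j)%R) m2).
    - by move=> u _; rewrite -EFinD lee_fin exp_le_step.
  rewrite ge0_integralD//; first last.
  - exact: (mst (fun j u => (q u < exp_threshold t J j)%R) m2).
  - by move=> u _; rewrite lee_fin mulr_ge0// sumr_ge0.
  rewrite EFinD GEs leeD//.
    rewrite (intE (fun j u => (q u < exp_threshold t J j)%R))// lee_wpmul2l ?lee_fin//.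
    by apply: lee_sum => j _; apply: unif_quantile_lt => //; exact: exp_threshold_ge0.
  rewrite integral_cst// -[leRHS]mule1 lee_wpmul2l ?lee_fin//; exact: probability_le1.
have If : I \is a fin_num.
  have [h1 h2] := step 1%N isT.
  by rewrite fin_numE -ltNye -ltey (lt_le_trans (ltNyr _) h1) (le_lt_trans h2 (ltry _)).
rewrite -(fineK If); congr EFin; apply/eqP; rewrite -subr_eq0 -normr_le0.
apply/ler_addgt0Pr => e e0; rewrite add0r.
have [J J0 Je] : exists2 J : nat, (0 < J)%N & J%:R^-1 <= e.
  exists (Num.truncn e^-1).+1 => //.
  by rewrite invf_ple ?posrE// ltW// truncnS_gt.
have [] := step J J0; rewrite -(fineK If) !lee_fin => h1 h2.
have /andP[h3 h4] := G_step t J J0 t01.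
by rewrite ler_norml; lra.
Qed.

End laplace_limit.

(** * The law of the number of zero decrements *)

Section zero_decrement_law.
Variables (R : realType) (M : nat).

(** The law of the number of zero decrements among the first [K] steps from
    [i], computed by a decomposition on the first step. *)
Fixpoint zlaw (s : nat -> nat -> R) (K i k : nat) : R :=
  if K is K'.+1 then
    if (i <= M)%N then (k == 0%N)%:R
    else \sum_(M <= j < i) s i j * zlaw s K' j k +
         (if k is k'.+1 then s i i * zlaw s K' i k' else 0)
  else (k == 0%N)%:R.

Lemma zlawS s K i k : zlaw s K.+1 i k =
  if (i <= M)%N then (k == 0%N)%:R
  else \sum_(M <= j < i) s i j * zlaw s K j k +
       (if k is k'.+1 then s i i * zlaw s K i k' else 0).
Proof. by []. Qed.

(** After [i + k] steps the chain from [i] is absorbed or has made more than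
    [k] zero decrements, so a longer horizon gives the same mass at [k]. *)
Definition zpmf s i k := zlaw s (i + k) i k.

Lemma zlaw_absorbed s K k : zlaw s K M k = (k == 0%N)%:R.
Proof. by case: K => [//|K] /=; rewrite leqnn. Qed.

Lemma zlaw_stable s K i k : (i + k <= K)%N -> zlaw s K i k = zpmf s i k.
Proof.
have H K' : forall i k, (i + k <= K')%N -> zlaw s K'.+1 i k = zlaw s K' i k.
  elim: K' => [|K' IH] i' k' ik.
    by move: ik; rewrite leqn0 addn_eq0 => /andP[/eqP -> /eqP ->].
  rewrite (zlawS s K'.+1 i' k') (zlawS s K' i' k'); case: leqP => // Mi.
  congr (_ + _).
    apply: eq_big_nat => j /andP[_ ji]; congr (_ * _); apply: IH.
    by rewrite -ltnS (leq_trans _ ik)// -addSn leq_add2r.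
  case: k' ik => // k' ik; congr (_ * _); apply: IH.
  by rewrite -ltnS -addnS.
move=> /subnK <-; rewrite addnC; elim: (K - _)%N => [|n IH]; first by rewrite addn0.
by rewrite addnS H ?leq_addr.
Qed.

Lemma zpmf_absorbed s k : zpmf s M k = (k == 0%N)%:R.
Proof. exact: zlaw_absorbed. Qed.

Lemma zpmf_rec s i k : (M < i)%N ->
  zpmf s i k = \sum_(M <= j < i) s i j * zpmf s j k +
               (if k is k'.+1 then s i i * zpmf s i k' else 0).
Proof.
case: i => [//|i] Mi; rewrite {1}/zpmf addSn /= leqNgt Mi /=.
congr (_ + _).
  apply: eq_big_nat => j /andP[_ ji]; rewrite zlaw_stable//.
  by rewrite leq_add2r -ltnS.
by case: k => // k; rewrite zlaw_stable// addnS.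
Qed.

Section generating_function.
Variable s : nat -> nat -> R.
Hypothesis s_ge0 : forall i j, (M < i)%N -> 0 <= s i j.
Hypothesis s_sum1 : forall i, (M < i)%N -> \sum_(M <= j < i.+1) s i j = 1.
Hypothesis s_lt1 : forall i, (M < i)%N -> s i i < 1.

Let s_sum i : (M < i)%N -> \sum_(M <= j < i) s i j + s i i = 1.
Proof. by move=> Mi; rewrite -big_nat_recr ?s_sum1// ltnW. Qed.

Lemma zlaw_ge0 K i k : 0 <= zlaw s K i k.
Proof.
elim: K i k => [|K IH] i k /=; first by rewrite ler0n.
case: leqP => [_|Mi]; first by rewrite ler0n.
rewrite addr_ge0 ?sumr_ge0// => [j _|]; first by rewrite mulr_ge0// s_ge0.
by case: k => // k; rewrite mulr_ge0// s_ge0.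
Qed.

Lemma zpmf_ge0 i k : 0 <= zpmf s i k. Proof. exact: zlaw_ge0. Qed.

Let S z i N := series (fun k => zpmf s i k * z ^+ k) N.

Let S_rec z i N : (M < i)%N ->
  S z i N.+1 = \sum_(M <= j < i) s i j * S z j N.+1 + s i i * z * S z i N.
Proof.
move=> Mi; rewrite /S /series/=.
rewrite (eq_bigr (fun k => (\sum_(M <= j < i) s i j * zpmf s j k) * z ^+ k +
  (if k is k'.+1 then s i i * zpmf s i k' else 0) * z ^+ k)); last first.
  by move=> k _; rewrite zpmf_rec// mulrDl.
rewrite big_split/=; congr (_ + _).
  under eq_bigr do rewrite mulr_suml.
  rewrite exchange_big/=; apply: eq_bigr => j _.
  by rewrite mulr_sumr; apply: eq_bigr => k _; rewrite mulrA.
rewrite big_nat_recl//= mul0r add0r mulr_sumr; apply: eq_bigr => k _.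
by rewrite exprS; ring.
Qed.

Let S_absorbed z N : S z M N.+1 = 1.
Proof.
rewrite /S/series/= big_nat_recl//= zpmf_absorbed eqxx mul1r expr0 big1 ?addr0//.
by move=> k _; rewrite zpmf_absorbed mul0r.
Qed.

Lemma zpmf_series_ge0 z i N : 0 <= z -> 0 <= S z i N.
Proof. by move=> z0; apply: sumr_ge0 => k _; rewrite mulr_ge0 ?zpmf_ge0 ?exprn_ge0. Qed.

Lemma zpmf_series_le1 z i N : 0 <= z <= 1 -> (M <= i)%N -> S z i N <= 1.
Proof.
move=> /andP[z0 z1]; elim/ltn_ind: i N => i IHi N.
rewrite leq_eqVlt => /predU1P[<-|Mi].
  by case: N => [|N]; [rewrite /S/series/= big_geq// ler01|rewrite S_absorbed].
elim: N => [|N IHN]; first by rewrite /S/series/= big_geq// ler01.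
rewrite S_rec// -(s_sum Mi) lerD//.
  apply: ler_sum_nat => j /andP[Mj ji]; rewrite ler_piMr ?s_ge0//; exact: IHi.
have := zpmf_series_ge0 i N z0; have := s_ge0 i Mi => s0 S0.
by rewrite -mulrA ler_piMr// mulr_ile1.
Qed.

Definition zpgf z i := limn (S z i).

Lemma zpgf_cvg z i : 0 <= z <= 1 -> (M <= i)%N ->
  series (fun k => zpmf s i k * z ^+ k) @ \oo --> zpgf z i.
Proof.
move=> z01 Mi; have /andP[z0 z1] := z01; apply: nondecreasing_is_cvgn.
  by apply: nondecreasing_series => k _ _; rewrite mulr_ge0 ?zpmf_ge0 ?exprn_ge0.
by exists 1 => _ [N _ <-]; exact: zpmf_series_le1.
Qed.

Lemma zpgf_absorbed z : zpgf z M = 1.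
Proof.
apply/cvg_lim => //; rewrite -cvg_shiftS.
by rewrite (_ : (fun n => S z M n.+1) = cst 1); [exact: cvg_cst|apply/funext => n /=; exact: S_absorbed].
Qed.

(** First step decomposition of the generating function: starting from
    [i], each zero decrement costs a factor [s i i * z]. *)
Lemma zpgf_rec z i : 0 <= z <= 1 -> (M < i)%N ->
  zpgf z i * (1 - s i i * z) = \sum_(M <= j < i) s i j * zpgf z j.
Proof.
move=> z01 Mi; have c1 := zpgf_cvg z01 (ltnW Mi).
have c2 : S z i n.+1 @[n --> \oo] --> \sum_(M <= j < i) s i j * zpgf z j + s i i * z * zpgf z i.
  under eq_fun do rewrite S_rec//.
  apply: cvgD; last by apply: cvgMr.
  have -> : (fun n => \sum_(M <= j < i) s i j * S z j n.+1) =
      (fun n => \sum_(j < i) (if (M <= j)%N then s i j * S z j n.+1 else 0)).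
    by apply/funext => n; rewrite big_geq_mkord [LHS]big_mkcond.
  rewrite big_geq_mkord big_mkcond/=.
  apply: (@cvg_sum_ord R _ _ _ i (fun j n => if (M <= j)%N then s i j * S z j n.+1 else 0)
    (fun j => if (M <= j)%N then s i j * zpgf z j else 0)) => j ji.
  case: ifP => Mj; last exact: cvg_cst.
  apply: cvgMr; rewrite (cvg_shiftS (S z j)); exact: zpgf_cvg.
have c3 : S z i n.+1 @[n --> \oo] --> zpgf z i by rewrite (cvg_shiftS (S z i)).
have := cvg_unique _ c3 c2 => /(_ (@norm_hausdorff _ _)) e.
by rewrite mulrBr mulr1 {1}e; ring.
Qed.

Lemma zpgf_at1 i : (M <= i)%N -> zpgf 1 i = 1.
Proof.
elim/ltn_ind: i => i IH; rewrite leq_eqVlt => /predU1P[<-|Mi]; first exact: zpgf_absorbed.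
have h01 : 0 <= (1 : R) <= 1 by rewrite ler01 lexx.
have := zpgf_rec h01 Mi; rewrite mulr1.
rewrite (eq_big_nat _ _ (F2 := fun j => s i j)); last first.
  by move=> j /andP[Mj ji]; rewrite IH// mulr1.
have -> : \sum_(M <= j < i) s i j = 1 * (1 - s i i) by rewrite mul1r -(s_sum Mi) addrK.
by apply: mulIf; rewrite subr_eq0 eq_sym lt_eqF// s_lt1.
Qed.

End generating_function.

Section inverse_thinning.
Variable s : nat -> nat -> R.
Hypothesis s_ge0 : forall i j, (M < i)%N -> 0 <= s i j.
Hypothesis s_sum1 : forall i, (M < i)%N -> \sum_(M <= j < i.+1) s i j = 1.
Hypothesis s_lt1 : forall i, (M < i)%N -> s i i < 1.

Let s_sum i : (M < i)%N -> \sum_(M <= j < i) s i j = 1 - s i i.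
Proof. by move=> Mi; rewrite -(s_sum1 Mi) big_nat_recr ?addrK//= ltnW. Qed.

(** The transition matrix with the same jump chain in which the odds
    [s i i / (1 - s i i)] of waiting, hence the mean wait, are multiplied by
    [c]. *)
Definition inv_thin (c : R) i j := (if i == j then c else 1) * s i j / (1 + (c - 1) * s i i).

Variable c : R.
Hypothesis c1 : 1 <= c.

Let den_gt0 i : (M < i)%N -> 0 < 1 + (c - 1) * s i i.
Proof. by move=> Mi; rewrite ltr_pwDl// mulr_ge0 ?subr_ge0// s_ge0. Qed.

Lemma inv_thin_ge0 i j : (M < i)%N -> 0 <= inv_thin c i j.
Proof.
move=> Mi; rewrite /inv_thin divr_ge0 ?(ltW (den_gt0 Mi))// mulr_ge0 ?s_ge0//.
by case: (i == j); rewrite ?ler01// (le_trans ler01 c1).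
Qed.

Let inv_thin_lt i j : (j < i)%N -> inv_thin c i j = s i j / (1 + (c - 1) * s i i).
Proof. by move=> ji; rewrite /inv_thin gtn_eqF// mul1r. Qed.

Lemma inv_thin_sum1 i : (M < i)%N -> \sum_(M <= j < i.+1) inv_thin c i j = 1.
Proof.
move=> Mi; rewrite big_nat_recr/=; last exact: ltnW.
rewrite (eq_big_nat _ _ (F2 := fun j => s i j / (1 + (c - 1) * s i i))); last first.
  by move=> j /andP[_ ji]; rewrite inv_thin_lt.
rewrite -mulr_suml s_sum// /inv_thin eqxx -mulrDl.
by rewrite (_ : _ + _ = 1 + (c - 1) * s i i) ?divff ?gt_eqF ?den_gt0//; ring.
Qed.

Lemma inv_thin_lt1 i : (M < i)%N -> inv_thin c i i < 1.
Proof.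
move=> Mi; rewrite /inv_thin eqxx ltr_pdivrMr ?den_gt0// mul1r.
have := s_lt1 Mi; lra.
Qed.

(** The generating function of a geometric wait of mean [m] at [1 - t] is
    [1 / (1 + m t)], which depends only on the product of [m] and [t]. *)
Lemma zpgf_inv_thin i t : 0 <= t <= 1 -> (M <= i)%N ->
  zpgf (inv_thin c) (1 - t / c) i = zpgf s (1 - t) i.
Proof.
move=> t01; have c1' := c1; have c0 : 0 < c by exact: lt_le_trans ltr01 c1.
have z01 : 0 <= 1 - t <= 1 by lra.
have zc01 : 0 <= 1 - t / c <= 1.
  have : 0 <= t / c by rewrite divr_ge0; lra.
  have : t / c <= 1 by rewrite ler_pdivrMr; lra.
  lra.
elim/ltn_ind: i => i IH; rewrite leq_eqVlt => /predU1P[<-|Mi].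
  by rewrite !zpgf_absorbed.
have e1 := zpgf_rec inv_thin_ge0 inv_thin_sum1 zc01 Mi.
have e2 := zpgf_rec s_ge0 s_sum1 z01 Mi.
have := s_lt1 Mi; have := s_ge0 i Mi => si0 si1.
have d0 : 0 < 1 - s i i * (1 - t).
  have : s i i * (1 - t) <= s i i by rewrite ler_piMr//; lra.
  lra.
have D0 := den_gt0 Mi.
apply: (mulIf (x := 1 - s i i * (1 - t))); first by rewrite gt_eqF.
rewrite e2.
have -> : \sum_(M <= j < i) s i j * zpgf s (1 - t) j =
    (1 + (c - 1) * s i i) * \sum_(M <= j < i) inv_thin c i j * zpgf (inv_thin c) (1 - t / c) j.
  rewrite mulr_sumr; apply: eq_big_nat => j /andP[Mj ji]; rewrite IH// inv_thin_lt//.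
  by field; rewrite gt_eqF.
rewrite -e1 /inv_thin eqxx; field.
by rewrite !gt_eqF.
Qed.

End inverse_thinning.

(** The bound is uniform in the exponent, because [x ^+ k - y ^+ k] is
    [x - y] times at most the sum of the geometric series. *)
Lemma expr_sub_le (x y : R) k : 0 <= y -> y <= x -> x < 1 ->
  x ^+ k <= y ^+ k + (x - y) / (1 - x).
Proof.
move=> y0 yx x1; have d0 : 0 < 1 - x by lra.
suff : x ^+ k - y ^+ k <= (x - y) * ((1 - x ^+ k) / (1 - x)).
  move=> h; rewrite -lerBlDl (le_trans h)// ler_wpM2l ?subr_ge0//.
  rewrite ler_piMl ?invr_ge0 ?(ltW d0)// lerBlDr lerDl exprn_ge0//.
  exact: le_trans yx.
elim: k => [|k IH]; first by rewrite !expr0 subrr mul0r mulr0.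
have xk0 : 0 <= x ^+ k - y ^+ k by rewrite subr_ge0 lerXn2r// nnegrE ?(le_trans y0 yx).
have -> : x ^+ k.+1 - y ^+ k.+1 = x ^+ k * (x - y) + y * (x ^+ k - y ^+ k) by rewrite !exprS; ring.
have -> : (x - y) * ((1 - x ^+ k.+1) / (1 - x)) =
    x ^+ k * (x - y) + (x - y) * ((1 - x ^+ k) / (1 - x)).
  by rewrite exprS; field; rewrite gt_eqF.
rewrite lerD2l (le_trans _ IH)// ler_piMl//; lra.
Qed.

Lemma bernoulli_pow (t : R) K : 0 <= t <= 1 -> 1 - K%:R * t <= (1 - t) ^+ K.
Proof.
move=> /andP[t0 t1]; elim: K => [|K IH]; first by rewrite mul0r subr0 expr0.
rewrite exprS -natr1.
have : (1 - t) * (1 - K%:R * t) <= (1 - t) * (1 - t) ^+ K by rewrite ler_wpM2l// subr_ge0.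
have : 0 <= K%:R * t * t by rewrite !mulr_ge0.
lra.
Qed.

Section limit_law.
Variable s : nat -> nat -> R.
Hypothesis s_ge0 : forall i j, (M < i)%N -> 0 <= s i j.
Hypothesis s_sum1 : forall i, (M < i)%N -> \sum_(M <= j < i.+1) s i j = 1.
Hypothesis s_lt1 : forall i, (M < i)%N -> s i i < 1.
Variable p : nat -> R.
Hypothesis s_p : forall k, zpmf s i k @[i --> \oo] --> p k.
Hypothesis p_sum1 : series p @ \oo --> (1 : R).

Let p_ge0 k : 0 <= p k.
Proof. by apply: (cvgr_to_ge (s_p (k := k))); apply: nearW => i; exact: zpmf_ge0. Qed.

Let p_le1 k : p k <= 1.
Proof.
apply: le_trans (series_le_lim k.+1 p_ge0 p_sum1).
by rewrite /series/= big_nat_recr//= lerDr sumr_ge0.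
Qed.

Let f z : R := limn (series (fun k => p k * z ^+ k)).

Let f_cvg z : 0 <= z <= 1 -> series (fun k => p k * z ^+ k) @ \oo --> f z.
Proof.
move=> /andP[z0 z1]; apply: cvg_series_le1 => // k.
by rewrite exprn_ge0// exprn_ile1.
Qed.

Let idx n := maxn n M.

Let M_idx n : (M <= idx n)%N. Proof. exact: leq_maxr. Qed.

Let s_p_idx k : zpmf s (idx n) k @[n --> \oo] --> p k.
Proof.
apply: cvg_trans (s_p (k := k)); apply: near_eq_cvg.
by exists M => // n /= Mn; rewrite /idx (maxn_idPl Mn).
Qed.

Let zpmf_le1 i k : (M <= i)%N -> zpmf s i k <= 1.
Proof.
move=> Mi; have h01 : 0 <= (1 : R) <= 1 by rewrite ler01 lexx.
apply: le_trans (zpmf_series_le1 s_ge0 s_sum1 k.+1 h01 Mi).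
rewrite /series/= big_nat_recr//= expr1n mulr1 lerDr sumr_ge0// => j _.
by rewrite expr1n mulr1 zpmf_ge0.
Qed.

Let tail_bounds (a : nat -> R) (l z : R) K : 0 < z < 1 -> (forall k, 0 <= a k <= 1) ->
  series (fun k => a k * z ^+ k) @ \oo --> l ->
  series (fun k => a k * z ^+ k) K <= l <= series (fun k => a k * z ^+ k) K + z ^+ K / (1 - z).
Proof.
move=> z01 a01 al; have [z0 z1] := andP z01; apply/andP; split.
  apply: series_le_lim al => k; rewrite mulr_ge0 ?exprn_ge0 ?(ltW z0)//.
  by case/andP: (a01 k).
apply: (lim_le_eventually (m := K) al) => n Kn.
rewrite /series/= (@big_cat_nat _ _ _ K)//= lerD2l.
by apply: series_geo_tail => //; rewrite ltW.
Qed.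

(** The tails of the generating functions are bounded by that of the geometric
    series, uniformly in the starting state. *)
Let zpgf_lim z : 0 < z < 1 -> zpgf s z (idx n) @[n --> \oo] --> f z.
Proof.
move=> z01; have [z0 z1] := andP z01; have zz : 0 <= z <= 1 by rewrite !ltW.
apply/cvgrPdist_le => e e0.
have zK : z ^+ K / (1 - z) @[K --> \oo] --> (0 : R).
  rewrite -(mul0r (1 - z)^-1); apply: cvgMl; apply: cvg_expr.
  by rewrite gtr0_norm.
have e20 : 0 < e / 2 by rewrite divr_gt0.
have [K _ /(_ K (leqnn K)) hK] : \forall K \near \oo, z ^+ K / (1 - z) <= e / 2.
  by apply: (cvgr_le _ zK).
have SK : series (fun k => zpmf s (idx n) k * z ^+ k) K @[n --> \oo] --> series (fun k => p k * z ^+ k) K.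
  rewrite /series/= big_mkord; under eq_fun do rewrite big_mkord.
  apply: (@cvg_sum_ord R _ _ _ K (fun k n => zpmf s (idx n) k * z ^+ k) (fun k => p k * z ^+ k)) => k _.
  by apply: cvgMl; exact: s_p_idx.
move/cvgrPdist_le : SK => /(_ _ e20); apply: filterS => n hn.
have a01 k : 0 <= zpmf s (idx n) k <= 1 by rewrite zpmf_ge0//= zpmf_le1.
have p01 k : 0 <= p k <= 1 by rewrite p_ge0 p_le1.
have := tail_bounds K z01 a01 (zpgf_cvg s_ge0 s_sum1 zz (M_idx n)).
have := tail_bounds K z01 p01 (f_cvg zz).
move: hn; rewrite !ler_norml; lra.
Qed.

Theorem mixture_of_limit : exists q : {mfun measurableTypeR R >-> R},
  (forall u, 0 <= q u) /\
  forall k, (\int[unif R]_u (pois (q u) k)%:E = (p k)%:E)%E.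
Proof.
have p01 k : 0 <= p k <= 1 by rewrite p_ge0 p_le1.
have [c cE] : exists c : nat -> R, forall n, c n = n.+1%:R by exists (fun n => n.+1%:R).
have c1 n : 1 <= c n by rewrite cE ler1n.
have c0 n : 0 < c n by rewrite cE ltr0n.
pose r n k := zpmf (inv_thin s (c n)) (idx n) k.
pose x n k : R := k%:R / c n.
(* Evaluating the generating function of the thinned law at [exp(- t / c)]
   amounts to evaluating that of [Z_n] at [1 - th n t], with [th n t] close
   to [t]; this makes the Laplace transform of [k / c] exact. *)
pose th n (t : R) := c n * (1 - expR (- (t / c n))).
pose A n t := zpgf s (1 - th n t) (idx n).
have ri0 n i j : (M < i)%N -> 0 <= inv_thin s (c n) i j by exact: inv_thin_ge0.
have ri1 n i : (M < i)%N -> \sum_(M <= j < i.+1) inv_thin s (c n) i j = 1 by exact: inv_thin_sum1.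
have ril n i : (M < i)%N -> inv_thin s (c n) i i < 1 by exact: inv_thin_lt1.
have h01 : 0 <= (1 : R) <= 1 by rewrite ler01 lexx.
have tcth n t : 0 < t -> t * c n / (c n + t) <= th n t <= t.
  move=> t0; have tc0 : 0 < t / c n by rewrite divr_gt0.
  have h1 : 1 - t / c n <= expR (- (t / c n)) by exact: expR_ge1Dx.
  have h2 : 1 + t / c n <= expR (t / c n) by exact: expR_ge1Dx.
  have cn := c0 n.
  have h3 : expR (- (t / c n)) <= (1 + t / c n)^-1.
    by rewrite expRN lef_pV2 ?posrE ?expR_gt0// addr_gt0.
  apply/andP; split.
    have -> : t * c n / (c n + t) = c n * (1 - (1 + t / c n)^-1).
      by field; rewrite ?gt_eqF//; lra.
    by rewrite ler_pM2l//; lra.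
  apply: (@le_trans _ _ (c n * (t / c n))); first by rewrite /th ler_pM2l//; lra.
  by rewrite mulrC divfK ?gt_eqF.
have [q [q0 qh]] : exists q : {mfun measurableTypeR R >-> R},
    (forall u, 0 <= q u) /\
    forall t : R, 0 < t < 1 -> (\int[unif R]_u (expR (- (t * q u)))%:E = (f (1 - t))%:E)%E.
  apply: (@laplace_limit R r x A (fun t => f (1 - t))).
  - by move=> n k; exact: (zpmf_ge0 (ri0 n)).
  - move=> n; have := zpgf_cvg (ri0 n) (ri1 n) h01 (M_idx n).
    rewrite (zpgf_at1 (ri0 n) (ri1 n) (ril n))//.
    rewrite (_ : r n = fun k => zpmf (inv_thin s (c n)) (idx n) k * 1 ^+ k)//.
    by apply/funext => k; rewrite expr1n mulr1.
  - by move=> n k; rewrite divr_ge0// ltW.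
  - move=> n t /andP[t0 t1].
    have /andP[th1 th2] := tcth n t t0.
    have th0 : 0 <= th n t.
      by apply: le_trans th1; rewrite divr_ge0 ?mulr_ge0 ?addr_ge0 ?ltW.
    have tht01 : 0 <= th n t <= 1 by rewrite th0; lra.
    rewrite /A -(zpgf_inv_thin s_ge0 s_sum1 s_lt1 (c1 n) tht01 (M_idx n)).
    have eE : 1 - th n t / c n = expR (- (t / c n)).
      by rewrite /th; field; rewrite gt_eqF.
    have e01 : 0 <= expR (- (t / c n)) <= 1.
      by rewrite expR_ge0/= -expR0 ler_expR oppr_le0 divr_ge0 ?ltW.
    have := zpgf_cvg (ri0 n) (ri1 n) e01 (M_idx n); rewrite eE.
    rewrite [in X in _ -> X](_ : (fun k => r n k * expR (- (t * x n k))) =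
      (fun k => zpmf (inv_thin s (c n)) (idx n) k * expR (- (t / c n)) ^+ k))//.
    by apply/funext => k; rewrite /r -expRM_natl /x; congr (_ * expR _); ring.
  - move=> t t01; have /andP[t0 t1] := t01.
    have z01 : 0 < 1 - t < 1 by lra.
    have tc : t / c n @[n --> \oo] --> (0 : R).
      under eq_fun do rewrite cE.
      by rewrite -(mulr0 t); apply: cvgMr; exact: cvg_harmonic.
    have up : zpgf s (1 - t) (idx n) + t / c n @[n --> \oo] --> f (1 - t).
      by rewrite -[X in _ --> X]addr0; apply: cvgD => //; exact: zpgf_lim.
    apply: (squeeze_cvgr _ (zpgf_lim z01) up); apply: nearW => n.
    have /andP[th1 th2] := tcth n t t0; have cn := c0 n.
    have th0 : 0 < th n t.
      by apply: lt_le_trans th1; rewrite divr_gt0 ?mulr_gt0 ?addr_gt0.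
    have zz : 0 <= 1 - t <= 1 by lra.
    have zt : 0 <= 1 - th n t <= 1 by lra.
    have B1 := zpgf_cvg s_ge0 s_sum1 zz (M_idx n).
    have B2 := zpgf_cvg s_ge0 s_sum1 zt (M_idx n).
    have B3 := zpgf_cvg s_ge0 s_sum1 h01 (M_idx n).
    rewrite zpgf_at1// in B3.
    apply/andP; split.
      apply: (ler_cvgs _ B1 B2) => N; apply: ler_sum => k _.
      by rewrite ler_wpM2l ?zpmf_ge0// lerXn2r ?nnegrE; lra.
    have B4 : series (fun k => zpmf s (idx n) k * (1 - t) ^+ k) N + t / c n * series (fun k => zpmf s (idx n) k * 1 ^+ k) N @[N --> \oo] --> zpgf s (1 - t) (idx n) + t / c n.
      have B5 : t / c n * series (fun k => zpmf s (idx n) k * 1 ^+ k) N @[N --> \oo] --> t / c n * 1.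
        exact: cvgMr.
      by move: B5; rewrite mulr1 => B5; exact: cvgD.
    apply: (ler_cvgs _ B2 B4) => N; rewrite /series/= mulr_sumr -big_split/=.
    apply: ler_sum => k _; rewrite expr1n mulr1 [t / c n * _]mulrC -mulrDr ler_wpM2l ?zpmf_ge0//.
    have y0 : 0 <= 1 - t by lra.
    have yx : 1 - t <= 1 - th n t by lra.
    have x1 : 1 - th n t < 1 by lra.
    apply: (le_trans (expr_sub_le k y0 yx x1)); rewrite lerD2l.
    rewrite (_ : 1 - (1 - th n t) = th n t); last ring.
    rewrite ler_pdivrMr//.
    have e3 : t - t * c n / (c n + t) = t / c n * (t * c n / (c n + t)).
      by field; rewrite ?gt_eqF//; lra.
    have : t / c n * (t * c n / (c n + t)) <= t / c n * th n t.
      by rewrite ler_wpM2l// divr_ge0// ltW.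
    lra.
  - move=> e e0.
    have [K _ /(_ K (leqnn K)) hK] : \forall K \near \oo, 1 - e / 2 <= series p K.
      by apply: (cvgr_ge _ p_sum1); lra.
    pose t := Num.min (1 / 2) (e / 2 / K.+1%:R).
    have t0 : 0 < t by rewrite lt_min; apply/andP; split; rewrite ?divr_gt0.
    have t2 : t <= 1 / 2 by rewrite ge_min lexx.
    have tK : t <= e / 2 / K.+1%:R by rewrite ge_min lexx orbT.
    exists t; first by lra.
    have zz : 0 <= 1 - t <= 1 by lra.
    have t01 : 0 <= t <= 1 by lra.
    apply: le_trans (series_le_lim K _ (f_cvg zz)); last first.
      by move=> k; rewrite mulr_ge0 ?exprn_ge0//; lra.
    have hB : 1 - e / 2 <= (1 - t) ^+ K.
      apply: le_trans (bernoulli_pow K t01); rewrite lerD2l lerN2.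
      apply: (@le_trans _ _ (K.+1%:R * t)); first by rewrite ler_wpM2r ?(ltW t0)// ler_nat.
      by rewrite mulrC -ler_pdivlMr.
    apply: (@le_trans _ _ ((1 - t) ^+ K * series p K)); last first.
      rewrite /series/= mulr_sumr; apply: ler_sum_nat => k /andP[_ kK].
      rewrite mulrC ler_wpM2l// ler_wiXn2l//; [lra|lra|exact: ltnW].
    have S1 : series p K <= 1 by exact: series_le_lim p_sum1.
    have S0 : 0 <= series p K by exact: sumr_ge0.
    have P1 : (1 - t) ^+ K <= 1 by rewrite exprn_ile1//; lra.
    have P0 : 0 <= (1 - t) ^+ K by rewrite exprn_ge0//; lra.
    nra.
exists q; split => //; apply: (laplace_mixture p01 q0 (h := fun t => f (1 - t))) => // z z01.
rewrite (_ : 1 - (1 - z) = z); last ring.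
by apply: f_cvg; rewrite !ltW; lra.
Qed.

End limit_law.

End zero_decrement_law.

(** * Zero decrements of a Markov chain *)

Section chain_law.
Variables (d : measure_display) (T : measurableType d) (R : realType).
Variables (P : probability T R) (M : nat) (s : nat -> nat -> R).
Variable Y : nat -> {RV P >-> nat}.
Hypothesis s_trans : nonincreasing_transition M s.
Hypothesis Y_markov : markov_chain s Y.

Definition zero_step k w : bool := (Y k w == Y k.+1 w) && (M < Y k w)%N.

Fixpoint zero_steps K k w : nat :=
  if K is K'.+1 then (zero_step k w + zero_steps K' k.+1 w)%N else 0%N.

Let mY k j : measurable [set w | Y k w = j].
Proof. exact: (measurable_funPTI (Y k) (@I : measurable [set j])). Qed.

Lemma measurable_zero_step k : measurable [set w | zero_step k w].
Proof.
rewrite (_ : [set w | _] = \bigcup_(j in [set j | (M < j)%N]) ([set w | Y k w = j] `&` [set w | Y k.+1 w = j])).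
  by apply: bigcup_measurable => j _; exact: measurableI.
apply/seteqP; split => w /=.
  by move=> /andP[/eqP e h]; exists (Y k w).
by move=> [j Mj [e1 e2]]; rewrite /zero_step e1 e2 eqxx.
Qed.

Lemma measurable_zero_steps K k x : measurable [set w | zero_steps K k w = x].
Proof.
elim: K k x => [|K IH] k x.
  by case: x => [|x]; [rewrite (_ : [set w | _] = setT)//; apply/seteqP; split|rewrite (_ : [set w | _] = set0)//; apply/seteqP; split].
have mk := measurable_zero_step k.
rewrite (_ : [set w | _] =
  (~` [set w | zero_step k w] `&` [set w | zero_steps K k.+1 w = x]) `|`
  ([set w | zero_step k w] `&` (if x is x'.+1 then [set w | zero_steps K k.+1 w = x'] else set0))).
  apply: measurableU; apply: measurableI => //; first exact: measurableC.
  by case: x.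
apply/seteqP; split => w /=; case: (zero_step k w).
- by rewrite add1n; case: x => // x [] <-; right.
- by rewrite add0n => <-; left.
- by case=> [[//]|[_]]; case: x => // x ->.
- by case=> [[_ ->]|[//]].
Qed.

Let past k y := [set w | forall i, (i <= k)%N -> Y i w = y i].

Let mpast k y : measurable (past k y).
Proof.
rewrite (_ : past k y = \bigcap_(i in [set i | (i <= k)%N]) [set w | Y i w = y i]).
  by apply: bigcap_measurable => [|i _]; [exists 0%N|].
by apply/seteqP; split => w h i; exact: h.
Qed.

Let next k (y : nat -> nat) j i := if (i <= k)%N then y i else j.

Let past_next k y j : past k.+1 (next k y j) = past k y `&` [set w | Y k.+1 w = j].
Proof.
apply/seteqP; split => w /=.
  move=> h; split; last by have := h k.+1 (leqnn _); rewrite /next ltnn.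
  by move=> i ik; have := h i (leqW ik); rewrite /next ik.
move=> [h1 h2] i; rewrite leq_eqVlt /next ltnS => /predU1P[->|ik]; first by rewrite ltnn.
by rewrite ik h1.
Qed.

Let P_next k y j : P (past k y `&` [set w | Y k.+1 w = j]) = (P (past k y) * (s (y k) j)%:E)%E.
Proof.
have [p0|p0] := eqVneq (P (past k y)) 0%E.
  rewrite p0 mul0e; apply/eqP; rewrite eq_le measure_ge0 andbT -p0.
  by apply: le_measure; rewrite ?inE//; exact: measurableI.
have := @Y_markov k y j p0; rewrite /cond_prob -/(past k y) => <-.
have f1 : P (past k y) \is a fin_num by exact: fin_num_measure.
have f2 : P ([set w | Y k.+1 w = j] `&` past k y) \is a fin_num.
  by apply: fin_num_measure; exact: measurableI.
rewrite [in LHS]setIC -(fineK f2) -[in X in (X * _)%E](fineK f1) -EFinM; congr EFin.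
by rewrite mulrCA divff ?mulr1//; apply: contra p0 => /eqP e; rewrite -(fineK f1) e.
Qed.

Let P_range (E : set T) k a b : measurable E -> (a <= b)%N ->
  P (E `&` [set w | (a <= Y k w < b)%N]) = (\sum_(a <= j < b) P (E `&` [set w | Y k w = j]))%E.
Proof.
move=> mE /subnK <-; elim: (b - a)%N => [|n IH].
  rewrite add0n big_geq// (_ : _ `&` _ = set0) ?measure0//.
  by apply/seteqP; split => w //= -[_]; case: ltngtP.
rewrite addSn big_nat_recr/=; last exact: leq_addl.
have mr c : measurable [set w | (a <= Y k w < c)%N].
  rewrite (_ : [set w | _] = \bigcup_(j in [set j | (a <= j < c)%N]) [set w | Y k w = j]).
    by apply: bigcup_measurable => j _.
  apply/seteqP; split => w /=; first by exists (Y k w).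
  by move=> [j aj ->].
rewrite -IH -measureU//.
- congr (P _); rewrite -setIUr; congr (_ `&` _); apply/seteqP; split => w /=.
    by rewrite ltnS [(_ <= n + a)%N]leq_eqVlt => /andP[-> /predU1P[->|->]]; [right|left].
  by case=> [/andP[-> h]|->]; [rewrite ltnS ltnW|rewrite leq_addl ltnS leqnn].
- exact: measurableI.
- exact: measurableI.
by apply/seteqP; split => w //= -[[_ /andP[_ h]] [_ e]]; rewrite e ltnn in h.
Qed.

(** Condition on the next state, which lies between [M] and [y k]; a zero
    decrement is used up exactly when it equals [y k > M]. *)
Lemma zero_steps_law K k y x : (M <= y k)%N ->
  P (past k y `&` [set w | zero_steps K k w = x]) = (P (past k y) * (zlaw M s K (y k) x)%:E)%E.
Proof.
have [s0 s_out s_sum sMM] := s_trans.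
elim: K k y x => [|K IH] k y x My.
  case: x => [|x] /=.
    by rewrite (_ : [set w | _] = setT) ?setIT ?mule1//; apply/seteqP; split.
  by rewrite (_ : [set w | _] = set0) ?setI0 ?measure0 ?mule0//; apply/seteqP; split.
set W := [set w | _]; have mW : measurable W by exact: measurable_zero_steps.
set i := y k; set B := [set w | (M <= Y k.+1 w < i.+1)%N].
have Mi1 : (M <= i.+1)%N by exact: leqW.
have fA : P (past k y) \is a fin_num by exact: fin_num_measure.
have PAB : P (past k y `&` B) = P (past k y).
  rewrite P_range//; under eq_bigr do rewrite P_next.
  rewrite -(fineK fA); under eq_bigr do rewrite -EFinM.
  by rewrite sumEFin -mulr_sumr s_sum// mulr1.
have mB : measurable B.
  rewrite (_ : B = \bigcup_(j in [set j | (M <= j < i.+1)%N]) [set w | Y k.+1 w = j]).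
    by apply: bigcup_measurable => j _.
  apply/seteqP; split => w /=; first by exists (Y k.+1 w).
  by move=> [j aj /= e]; rewrite /B /= e.
have mAB : measurable (past k y `&` B) by exact: measurableI.
have mAnB : measurable (past k y `\` B) by exact: measurableD.
have PAnB : P (past k y `\` B) = 0%E.
  rewrite measureD//; last by rewrite -ge0_fin_numE.
  by rewrite [X in (_ - X)%E]PAB subee.
have mAW : measurable (past k y `&` W) by exact: measurableI.
have -> : P (past k y `&` W) = P ((past k y `&` W) `&` B).
  rewrite -[in LHS](setIT (past k y `&` W)) -(setUv B) setIUr measureU//; last 3 first.
  - exact: measurableI.
  - by apply: measurableI => //; exact: measurableC.
  - by rewrite setIACA setICr setI0.
  rewrite [X in (_ + X)%E](_ : _ = 0%E) ?adde0//.
  apply/eqP; rewrite eq_le measure_ge0 andbT -PAnB; apply: le_measure; rewrite ?inE//.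
    by apply: measurableI => //; exact: measurableC.
  by move=> w [[h1 _] h2].
rewrite P_range//.
have term j : (M <= j <= i)%N -> P (past k y `&` W `&` [set w | Y k.+1 w = j]) =
    (P (past k y) * (s i j * (if (j == i) && (M < i)%N then (if x is x'.+1 then zlaw M s K j x' else 0) else zlaw M s K j x))%:E)%E.
  move=> /andP[Mj ji].
  have Mn : (M <= next k y j k.+1)%N by rewrite /next ltnn.
  have L x' : P (past k.+1 (next k y j) `&` [set w | zero_steps K k.+1 w = x']) =
     (P (past k y) * (s i j * zlaw M s K j x')%:E)%E.
    by rewrite IH// /next ltnn -/(next k y j) past_next P_next -muleA -EFinM.
  case: ifPn => [/andP[/eqP ji' Mi]|jiM].
    case: x @W mW mAW => [|x] W mW mAW.
      rewrite mulr0 mule0 (_ : _ `&` _ = set0) ?measure0//.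
      apply/seteqP; split => w //= -[[h1]]; rewrite /W /= /zero_step h1// -/i.
      by move=> h2 h3; move: h2; rewrite h3 ji' eqxx Mi.
    rewrite -L past_next; congr (P _); apply/seteqP; split => w /=.
      move=> [[h1 h2] h3]; split => //; move: h2; rewrite /W /= /zero_step h1// h3 ji' -/i eqxx Mi add1n.
      by case.
    move=> [[h1 h3] h2]; split => //; split => //.
    by rewrite /W /= /zero_step h1// h3 ji' -/i eqxx Mi add1n h2.
  rewrite -L past_next; congr (P _); apply/seteqP; split => w /=.
    move=> [[h1 h2] h3]; split => //; move: h2; rewrite /W /= /zero_step h1// h3 -/i.
    by rewrite eq_sym (negbTE jiM) add0n.
  move=> [[h1 h3] h2]; split => //; split => //.
  by rewrite /W /= /zero_step h1// h3 -/i eq_sym (negbTE jiM) add0n h2.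
rewrite (eq_big_nat _ _ (F2 := fun j => P (past k y) * (s i j * (if (j == i) && (M < i)%N then (if x is x'.+1 then zlaw M s K j x' else 0) else zlaw M s K j x))%:E)%E); last exact: term.
rewrite -(fineK fA); under eq_bigr do rewrite -EFinM.
rewrite sumEFin -mulr_sumr -EFinM; congr (EFin (_ * _)).
rewrite zlawS big_nat_recr//= eqxx/=.
have [iM|Mi] := leqP i M.
  have -> : i = M by apply/eqP; rewrite eqn_leq iM.
  by rewrite big_geq// add0r sMM mul1r zlaw_absorbed.
congr (_ + _); last by case: x {W mW mAW term} => [|x]; rewrite ?mulr0.
by apply: eq_big_nat => j /andP[_ ji]; rewrite ltn_eqF.
Qed.

Lemma zero_steps_series K k w : zero_steps K k w = (\sum_(i < K) zero_step (k + i) w)%N.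
Proof.
elim: K k => [|K IH] k; first by rewrite big_ord0.
rewrite big_ord_recl/= addn0 IH; congr (_ + _)%N.
by apply: eq_bigr => i _; rewrite /bump /= add1n addnS addSn.
Qed.

Lemma zero_decrements_leE w (x : R) :
  (zero_decrements R M (fun k => Y k) w <= x%:E)%E <->
  forall K, (zero_steps K 0 w)%:R <= x.
Proof.
have sE K : (\sum_(0 <= n < K) \d_n [set k | Y k w = Y k.+1 w /\ (M < Y k w)%N])%E =
    ((zero_steps K 0 w)%:R)%:E :> \bar R.
  rewrite zero_steps_series natr_sum -sumEFin big_mkord; apply: eq_bigr => i _.
  rewrite add0n diracE /zero_step; congr ((_%:R)%:E); congr nat_of_bool.
  apply/idP/idP; first by move=> /set_mem[-> ->]; rewrite eqxx.
  by move=> /andP[/eqP h1 h2]; apply/mem_set.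
rewrite /zero_decrements counting_dirac; split.
  move=> h K; rewrite -lee_fin -sE; apply: le_trans h.
  exact: nneseries_lim_ge.
move=> h; apply: lime_le; first exact: is_cvg_nneseries.
by apply: nearW => K; rewrite sE lee_fin.
Qed.

Variable n : nat.
Hypothesis Mn : (M <= n)%N.
Hypothesis Y0 : P [set w | Y 0%N w = n] = 1%E.

Lemma zero_steps_pmf K x : P [set w | zero_steps K 0 w = x] = (zlaw M s K n x)%:E.
Proof.
have pE : [set w | forall i, (i <= 0)%N -> Y i w = n] = [set w | Y 0%N w = n].
  by apply/seteqP; split => w /=; [apply|move=> h i; rewrite leqn0 => /eqP ->].
have := @zero_steps_law K 0%N (fun=> n) x Mn; rewrite /past pE Y0 mul1e => <-.
have mW := measurable_zero_steps K 0%N x.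
have m0 := mY 0 n.
have P0 : P (~` [set w | Y 0%N w = n]) = 0%E.
  by rewrite (probability_setC P m0) Y0 subee.
rewrite -[in LHS](setTI [set w | _]) -(setUv [set w | Y 0%N w = n]) setIUl measureU//.
- rewrite [X in (_ + X)%E](_ : _ = 0%E) ?adde0//.
  apply/eqP; rewrite eq_le measure_ge0 andbT -P0; apply: le_measure; rewrite ?inE//.
  + by apply: measurableI => //; exact: measurableC.
  + exact: measurableC.
- exact: measurableI.
- by apply: measurableI => //; exact: measurableC.
- by rewrite setIACA setICr set0I.
Qed.

Lemma zero_steps_cdf K m : P [set w | (zero_steps K 0 w <= m)%N] =
  (\sum_(x < m.+1) zlaw M s K n x)%:E.
Proof.
pose F x := [set w | zero_steps K 0 w = x].
rewrite (_ : [set w | _] = \big[setU/set0]_(x < m.+1) F x); last first.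
  rewrite -(bigcup_mkord m.+1 F); apply/seteqP; split => w /=; first by exists (zero_steps K 0 w).
  by move=> [x xm ->].
rewrite (measure_bigsetU P (F := F)); last 2 first.
- by move=> x; exact: measurable_zero_steps.
- by move=> i j _ _ [w [/= <- <-]].
by rewrite -sumEFin; apply: eq_bigr => x _; exact: zero_steps_pmf.
Qed.

Lemma zero_steps_nd K K' k w : (K <= K')%N -> (zero_steps K k w <= zero_steps K' k w)%N.
Proof. by elim: K K' k => [|K IH] [|K'] k //= KK'; rewrite leq_add2l IH. Qed.

(** The total number is the increasing limit of the numbers up to a finite
    horizon, whose distribution functions at [m] are constant from the horizon
    [n + m] on. *)
Lemma zero_decrements_cdf m (x : R) : m%:R <= x < m.+1%:R ->
  ecdf P (zero_decrements R M (fun k => Y k)) x = (\sum_(k < m.+1) zpmf M s n k)%:E.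
Proof.
move=> /andP[mx xm].
have mS K : measurable [set w | (zero_steps K 0 w <= m)%N].
  rewrite (_ : [set w | _] = \bigcup_(x in [set x | (x <= m)%N]) [set w | zero_steps K 0 w = x]).
    by apply: bigcup_measurable => i _; exact: measurable_zero_steps.
  by apply/seteqP; split => w /=; [exists (zero_steps K 0 w)|move=> [i im ->]].
rewrite /ecdf (_ : [set w | _] = \bigcap_K [set w | (zero_steps K 0 w <= m)%N]); last first.
  apply/seteqP; split => w /=.
    move=> /zero_decrements_leE h K _ /=; rewrite -ltnS -(ltr_nat R).
    exact: le_lt_trans (h K) xm.
  move=> h; apply/zero_decrements_leE => K; apply: le_trans mx.
  by rewrite ler_nat; exact: h.
have c1 : P [set w | (zero_steps K 0 w <= m)%N] @[K --> \oo] -->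
    P (\bigcap_K [set w | (zero_steps K 0 w <= m)%N]).
  apply: nonincreasing_cvg_mu => //.
  - by rewrite (le_lt_trans (probability_le1 _ _))// ltry.
  - exact: bigcapT_measurable.
  - move=> K K' KK'; apply/subsetPset => w /=; apply: leq_trans; exact: zero_steps_nd.
apply: (cvg_unique _ c1) => //; apply: cvg_near_cst.
exists (n + m)%N => // K /= nmK; rewrite zero_steps_cdf; congr EFin.
apply: eq_bigr => k _; rewrite zlaw_stable// (leq_trans _ nmK)// leq_add2l.
by rewrite -ltnS.
Qed.

Lemma zero_decrements_cdf_neg (x : R) : x < 0 ->
  ecdf P (zero_decrements R M (fun k => Y k)) x = 0%E.
Proof.
move=> x0; rewrite /ecdf (_ : [set w | _] = set0) ?measure0//.
apply/seteqP; split => w //= /zero_decrements_leE/(_ 0%N).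
by rewrite leNgt x0.
Qed.

End chain_law.

(** * Limits of laws on the natural numbers *)

Section limit_of_laws.
Variables (R : realType) (dd : measure_display) (Om : measurableType dd).
Variables (Q : probability Om R) (Z : {RV Q >-> \bar R}).

(** A monotone function has countably many jumps, whereas intervals are
    uncountable. *)
Lemma nondecreasing_continuity_point (F : R -> R) a b : a < b ->
  {homo F : x y / x <= y} -> exists2 c, a < c < b & {for c, continuous F}.
Proof.
move=> ab Fnd; apply: contrapT => nc.
have cD : countable `]a, b[%classic.
  have := @discontinuity_countable R a b F (in2W Fnd); apply: sub_countable.
  apply: subset_card_le => c cab; split => //.
  have /cvg_ex[l Fl] : cvg (F x @[x --> c^'-]).
    apply: nondecreasing_at_left_is_cvgr.
      by near=> x => y z _ _; exact: Fnd.
    near=> x; exists (F c) => _ [y + <-].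
    by rewrite /= in_itv/= => /andP[_ /ltW]; exact: Fnd.
  have /cvg_ex[r Fr] : cvg (F x @[x --> c^'+]).
    apply: nondecreasing_at_right_is_cvgr.
      by near=> x => y z _ _; exact: Fnd.
    near=> x; exists (F c) => _ [y + <-].
    by rewrite /= in_itv/= => /andP[/ltW + _]; exact: Fnd.
  split; [exact: cvgP Fl|exact: cvgP Fr|].
  rewrite (cvg_lim _ Fl)// (cvg_lim _ Fr)//; apply/eqP => lr.
  apply: nc; exists c; first by move: cab; rewrite /= in_itv.
  have lc : l <= F c.
    apply: (cvgr_to_le Fl); near=> x; apply: Fnd.
    by near: x; exact: nbhs_left_le.
  have cr : F c <= r.
    apply: (cvgr_to_ge Fr); near=> x; apply: Fnd.
    by near: x; exact: nbhs_right_ge.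
  have lF : l = F c by apply/eqP; rewrite eq_le lc lr.
  apply/left_right_continuousP; split; first by rewrite -lF.
  by rewrite -lF lr.
have := countable_lebesgue_measure0 cD.
rewrite lebesgue_measure_itv/= lte_fin ab -EFinB => -[/eqP].
by rewrite subr_eq0 gt_eqF.
Unshelve. all: by end_near.
Qed.

Let F (x : R) := ecdf Q Z x.

Let mZ (A : set (\bar R)) : measurable A -> measurable (Z @^-1` A).
Proof. by move=> mA; exact: measurable_funPTI. Qed.

Let mle (x : R) : measurable [set w | (Z w <= x%:E)%E].
Proof.
exact: (mZ (emeasurable_itv `]-oo, x%:E])).
Qed.

Let F_fin x : F x \is a fin_num.
Proof. by apply: fin_num_measure; exact: mle. Qed.

Let F_nd x y : x <= y -> (F x <= F y)%E.
Proof.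
move=> xy; apply: le_measure; rewrite ?inE//; try exact: mle.
by move=> w /=; move/le_trans; apply; rewrite lee_fin.
Qed.

Lemma ecdf_continuity_point a b : a < b ->
  exists2 c, a < c < b & {for c, continuous (ecdf Q Z)}.
Proof.
move=> ab; have [|c cab cc] := @nondecreasing_continuity_point (fine \o F) a b ab.
  by move=> x y xy; rewrite /= fine_le ?F_nd.
exists c => //; suff : F x @[x --> c] --> (fine (F c))%:E by rewrite fineK.
apply: cvg_EFin; first by apply: nearW => x; exact: F_fin.
exact: cc.
Qed.

(** Exhaust ]a, b[ by intervals between continuity points. *)
Lemma null_between a b :
  (forall c c', a < c < b -> a < c' < b -> {for c, continuous (ecdf Q Z)} ->
     {for c', continuous (ecdf Q Z)} -> ecdf Q Z c = ecdf Q Z c') ->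
  Q [set w | (a%:E < Z w < b%:E)%E] = 0%E.
Proof.
move=> cF; have [ab|ba] := ltP a b; last first.
  rewrite (_ : [set w | _] = set0) ?measure0//; apply/seteqP; split => w //=.
  by move=> /andP[h1 h2]; move: (lt_trans h1 h2); rewrite lte_fin ltNge ba.
pose e (n : nat) : R := (b - a) / n.+2%:R.
have e0 n : 0 < e n by rewrite divr_gt0 ?subr_gt0.
have e2 n : e n <= (b - a) / 2.
  by rewrite ler_pM2l ?subr_gt0// lef_pV2 ?posrE// ler_nat.
have /choice[u uP] : forall n, exists c, a < c < a + e n /\ {for c, continuous (ecdf Q Z)}.
  by move=> n; have [|c h1 h2] := @ecdf_continuity_point a (a + e n); [rewrite ltrDl|exists c].
have /choice[v vP] : forall n, exists c, b - e n < c < b /\ {for c, continuous (ecdf Q Z)}.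
  by move=> n; have [|c h1 h2] := @ecdf_continuity_point (b - e n) b; [rewrite ltrBlDr ltrDl|exists c].
have mI n : measurable [set w | ((u n)%:E < Z w <= (v n)%:E)%E].
  exact: (mZ (emeasurable_itv `](u n)%:E, (v n)%:E])).
have I0 n : Q [set w | ((u n)%:E < Z w <= (v n)%:E)%E] = 0%E.
  have [/andP[u1 u2] uc] := uP n; have [/andP[v1 v2] vc] := vP n.
  have e2n := e2 n; have e0n := e0 n.
  rewrite (_ : [set w | _] = [set w | (Z w <= (v n)%:E)%E] `\` [set w | (Z w <= (u n)%:E)%E]); last first.
    by apply/seteqP; split => w /=; rewrite ltNge; [move=> /andP[/negP]|move=> [-> /negP ->]].
  rewrite measureD//; last by rewrite -ge0_fin_numE//; exact: F_fin.
  rewrite setIidr; last by move=> w /= /le_trans; apply; rewrite lee_fin; lra.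
  have Fuv : ecdf Q Z (v n) = ecdf Q Z (u n) by apply: cF => //; lra.
  by rewrite [X in (X - _)%E]Fuv subee//; exact: F_fin.
apply/eqP; rewrite eq_le measure_ge0 andbT.
apply: (@le_trans _ _ (Q (\bigcup_n [set w | ((u n)%:E < Z w <= (v n)%:E)%E]))).
  apply: le_measure; rewrite ?inE.
  - exact: (mZ (emeasurable_itv `]a%:E, b%:E[)).
  - exact: bigcupT_measurable.
  move=> w /= abZ.
  have [y Zy] : exists y, Z w = y%:E.
    move: abZ; case: (Z w) => [y _|/andP[_]|/andP[]]; first by exists y.
      by rewrite ltNge leey.
    by rewrite ltNge leNye.
  move: abZ; rewrite Zy !lte_fin => /andP[ay yb].
  pose m := Num.min (y - a) (b - y).
  have m0 : 0 < m by rewrite lt_min !subr_gt0 ay yb.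
  have ba0 : 0 < b - a by rewrite subr_gt0.
  have [n en] : exists n, e n < m.
    exists (Num.truncn ((b - a) / m)); rewrite /e ltr_pdivrMr// mulrC -ltr_pdivrMr//.
    by apply: lt_trans (truncnS_gt _) _; rewrite ltr_nat.
  have h1 : m <= y - a by rewrite ge_min lexx.
  have h2 : m <= b - y by rewrite ge_min lexx orbT.
  exists n => //=; have [/andP[u1 u2] _] := uP n; have [/andP[v1 v2] _] := vP n.
  by rewrite Zy lte_fin lee_fin; lra.
apply: (@le_trans _ _ (\sum_(0 <= n <oo) Q [set w | ((u n)%:E < Z w <= (v n)%:E)%E])%E).
  by apply: generalized_Boole_inequality => //; exact: bigcupT_measurable.
by rewrite eseries0// => n _ _; exact: I0.
Qed.

Hypothesis Z_proper : proper_law (distribution Q Z).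
Variables (E : nat -> R -> \bar R) (pm : nat -> nat -> R) (n0 : nat).
Hypothesis E_cvg : forall c, {for c, continuous (ecdf Q Z)} ->
  E n c @[n --> \oo] --> ecdf Q Z c.
Hypothesis E_nat : forall n m x, (n0 <= n)%N -> m%:R <= x < m.+1%:R ->
  E n x = (\sum_(k < m.+1) pm n k)%:E.
Hypothesis E_neg : forall n x, (n0 <= n)%N -> x < 0 -> E n x = 0%E.

Let E_same a b : (forall n c c', (n0 <= n)%N -> a < c < b -> a < c' < b -> E n c = E n c') ->
  Q [set w | (a%:E < Z w < b%:E)%E] = 0%E.
Proof.
move=> same; apply: null_between => c c' cab cab' /E_cvg Ec /E_cvg Ec'.
apply: (cvg_unique _ Ec) => //; apply: cvg_trans Ec'; apply: near_eq_cvg.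
by exists n0 => // n /= nn; exact: same.
Qed.

Let atom k := [set w | Z w = k%:R%:E].

Let m_atom k : measurable (atom k).
Proof. exact: mZ (emeasurable_set1 _). Qed.

Let atoms := \bigcup_k atom k.

Let trivIset_atom (D : set nat) : trivIset D atom.
Proof.
by move=> i j _ _ [w []]; rewrite /atom /= => -> [/eqP]; rewrite eqr_nat => /eqP.
Qed.

Let m_atoms : measurable atoms. Proof. exact: bigcupT_measurable. Qed.

Let m_between a b : measurable [set w | (a%:E < Z w < b%:E)%E].
Proof. exact: (mZ (emeasurable_itv `]a%:E, b%:E[)). Qed.

(** The approximating distribution functions are constant between consecutive
    integers and vanish on the negative numbers, so [null_between] applies to
    these intervals; infinite values are excluded by properness. *)
Let atoms_full : Q (~` atoms) = 0%E.
Proof.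
pose Inf := Z @^-1` (~` [set x : \bar R | x \is a fin_num]).
pose A n := [set w | ((- n%:R)%:E < Z w < 0%:E)%E].
pose B n := [set w | (n%:R%:E < Z w < n.+1%:R%:E)%E].
have mfin : measurable [set x : \bar R | x \is a fin_num].
  rewrite (_ : [set x | _] = EFin @` setT).
    exact: (measurable_image_EFin measurableT).
  by apply/seteqP; split => x /=; [move/fineK => <-; exists (fine x)|move=> [y _ <-]].
have mInf : measurable Inf by apply: mZ; exact: measurableC.
have I0 : Q Inf = 0%E.
  have -> : Q Inf = distribution Q Z (~` [set x : \bar R | x \is a fin_num]) by [].
  by rewrite probability_setC// Z_proper subee.
have A0 n : Q (A n) = 0%E.
  apply: E_same => i c c' ni /andP[_ c0] /andP[_ c'0].
  by rewrite !E_neg.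
have B0 n : Q (B n) = 0%E.
  apply: E_same => i c c' ni /andP[c1 c2] /andP[c'1 c'2].
  by rewrite !(@E_nat i n)// ?c2 ?c'2 ltW.
have mA n : measurable (A n) by exact: m_between.
have mB n : measurable (B n) by exact: m_between.
pose C n := if n is n'.+1 then A n' `|` B n' else Inf.
have mC n : measurable (C n) by case: n => [//|n]; exact: measurableU.
have C0 n : Q (C n) = 0%E.
  case: n => [//|n]; apply/eqP; rewrite eq_le measure_ge0 andbT.
  rewrite (le_trans (measureU2 _ (mA n) (mB n)))//.
  by rewrite [X in (X + _)%E]A0 [X in (_ + X)%E]B0 adde0.
apply/eqP; rewrite eq_le measure_ge0 andbT.
apply: (@le_trans _ _ (Q (\bigcup_n C n))).
  apply: le_measure; rewrite ?inE; [exact: measurableC|exact: bigcupT_measurable|].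
  move=> w /= nw; have [fZ|nfZ] := boolP (Z w \is a fin_num); last first.
    by exists 0%N => //=; apply/negP.
  have ZE := fineK fZ; have [z0|z0] := ltP (fine (Z w)) 0.
    exists (Num.truncn `|fine (Z w)|).+2 => //; left; rewrite /A /= -ZE !lte_fin z0 andbT.
    by rewrite ltrNl -(ltr0_norm z0) truncnS_gt.
  exists (Num.truncn (fine (Z w))).+1 => //; right; rewrite /B /= -ZE !lte_fin.
  rewrite truncnS_gt andbT lt_neqAle; have := truncn_le (fine (Z w)); rewrite z0 => ->.
  rewrite andbT; apply/eqP => e; apply: nw; exists (Num.truncn (fine (Z w))) => //.
  by rewrite /atom /= e ZE.
apply: (@le_trans _ _ (\sum_(0 <= n <oo) Q (C n))%E).
  by apply: generalized_Boole_inequality => //; exact: bigcupT_measurable.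
by rewrite eseries0// => n _ _; exact: C0.
Qed.

(** A continuity point between [m] and [m + 1] gives the convergence of the
    mass of [{0, ..., m}], and differences give single masses. *)
Theorem nat_valued_limit : exists p : nat -> R,
  [/\ forall k, distribution Q Z [set k%:R%:E] = (p k)%:E,
      (\sum_(0 <= k <oo) (p k)%:E = 1)%E
    & forall k, pm n k @[n --> \oo] --> p k].
Proof.
pose p k := fine (Q (atom k)).
have pE k : Q (atom k) = (p k)%:E by rewrite /p fineK// fin_num_measure.
exists p; split => //.
- have <- : Q atoms = 1%E.
    have := probability_setC Q m_atoms; rewrite atoms_full => e.
    have fa : Q atoms \is a fin_num by exact: fin_num_measure.
    move: e; rewrite -(fineK fa) -EFinB => -[/eqP].
    by rewrite eq_sym subr_eq0 => /eqP <-.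
  rewrite /atoms measure_bigcup//.
  rewrite (@eq_eseriesl _ (fun k => k \in setT) xpredT); last by move=> i; rewrite in_setT.
  by apply: eq_eseriesr => k _; rewrite -pE.
have cdfE m c : m%:R < c < m.+1%:R -> ecdf Q Z c = (\sum_(k < m.+1) p k)%:E.
  move=> /andP[mc cm]; rewrite /ecdf -[in LHS](setIT [set w | _]) -(setUv atoms) setIUr measureU//; last 3 first.
  - by apply: measurableI => //; exact: mle.
  - by apply: measurableI; [exact: mle|exact: measurableC].
  - by rewrite setIACA setICr setI0.
  rewrite [X in (_ + X)%E](_ : _ = 0%E) ?adde0; last first.
    apply/eqP; rewrite eq_le measure_ge0 andbT -atoms_full; apply: le_measure; rewrite ?inE//.
    + by apply: measurableI; [exact: mle|exact: measurableC].
    + exact: measurableC.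
  rewrite (_ : _ `&` _ = \big[setU/set0]_(k < m.+1) atom k); last first.
    rewrite -(bigcup_mkord m.+1 atom); apply/seteqP; split => w /=.
      move=> [Zc [k _ Zk]]; exists k => //=.
      by move: Zc; rewrite Zk lee_fin -(ltr_nat R) => /le_lt_trans; exact.
    move=> [k /= km Zk]; split; last by exists k.
    by rewrite Zk lee_fin (le_trans _ (ltW mc))// ler_nat -ltnS.
  rewrite (measure_bigsetU Q (F := atom))//.
  by rewrite -sumEFin; apply: eq_bigr => k _; rewrite -pE.
have cdf_cvg m : (\sum_(k < m.+1) pm n k) @[n --> \oo] --> \sum_(k < m.+1) p k.
  have [|c cm cc] := @ecdf_continuity_point m%:R m.+1%:R; first by rewrite ltr_nat.
  have := E_cvg cc; rewrite (cdfE m c cm) => /fine_cvgP[_].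
  apply: cvg_trans; apply: near_eq_cvg; exists n0 => // n /= nn.
  by have /andP[c1 c2] := cm; rewrite /= (@E_nat n m c)// c2 ltW.
move=> [|k].
  by have := cdf_cvg 0%N; rewrite big_ord1; under eq_fun do rewrite big_ord1.
have diff (a : nat -> R) : a k.+1 = \sum_(i < k.+2) a i - \sum_(i < k.+1) a i.
  by rewrite (big_ord_recr k.+1)/= addrAC subrr add0r.
by rewrite diff; under eq_fun do rewrite diff; exact: cvgB.
Qed.

End limit_of_laws.

Theorem proposition5p1 (R : realType) (M : nat) (s : nat -> nat -> R)
    (d : nat -> measure_display) (T : forall n : nat, measurableType (d n))
    (P : forall n : nat, probability (T n) R)
    (Y : forall n : nat, nat -> {RV (P n) >-> nat})
    (d' : measure_display) (T' : measurableType d') (Q : probability T' R)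
    (Z : {RV Q >-> \bar R}) :
  nonincreasing_transition M s ->
  (forall i : nat, (M < i)%N -> 0 < s i i.-1) ->
  (forall n : nat, (M <= n)%N -> (0 < n)%N ->
     P n [set w | Y n 0%N w = n] = 1%E /\ markov_chain s (Y n)) ->
  cvg_in_distribution P (fun n => zero_decrements R M (Y n)) Q Z ->
  proper_law (distribution Q Z) ->
  nondegenerate_law (distribution Q Z) ->
  mixed_poisson (distribution Q Z).
Proof.
move=> s_trans s_pred chain Z_cvg Z_proper _.
have [s_ge0 s_out s_sum sMM] := s_trans.
have [p [atomE p_sum pmf_cvg]] : exists p : nat -> R,
    [/\ forall k, distribution Q Z [set k%:R%:E] = (p k)%:E,
        (\sum_(0 <= k <oo) (p k)%:E = 1)%E
      & forall k, zpmf M s n k @[n --> \oo] --> p k].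
  apply: (@nat_valued_limit _ _ _ Q Z Z_proper
    (fun n => ecdf (P n) (zero_decrements R M (Y n))) (zpmf M s) (maxn M 1) Z_cvg).
  - move=> n m x; rewrite geq_max => /andP[Mn n0] mx.
    have [Y0 Y_markov] := chain n Mn n0.
    exact: (zero_decrements_cdf s_trans Y_markov Mn Y0 mx).
  - move=> n x _; exact: zero_decrements_cdf_neg.
have p_ge0 k : 0 <= p k by rewrite -lee_fin -atomE measure_ge0.
have p_series : series p @ \oo --> (1 : R).
  have : (\sum_(0 <= k < n) (p k)%:E)%E @[n --> \oo] --> 1%:E.
    by rewrite -p_sum; apply: is_cvg_nneseries => k _ _; rewrite lee_fin.
  by under eq_fun do rewrite sumEFin; move/fine_cvgP => [_].
have s_lt1 i : (M < i)%N -> s i i < 1.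
  case: i => // i Mi; have := s_pred _ Mi; rewrite /= => si.
  have := s_sum i.+1 (ltnW Mi); rewrite !big_nat_recr ?(ltnW Mi)//= => h.
  have : 0 <= \sum_(M <= j < i) s i.+1 j.
    by apply: sumr_ge0 => j _; rewrite s_ge0 ?(ltnW Mi).
  lra.
have [q [q0 qp]] := mixture_of_limit (fun i j Mi => s_ge0 i j (ltnW Mi))
  (fun i Mi => s_sum i (ltnW Mi)) s_lt1 pmf_cvg p_series.
exact: (mixed_poisson_of_mixture atomE p_sum q0 qp).
Qed.
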